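(* Let $K$ be any field of characteristic not equal to $2$. In the Grothendieck ring of varieties $K_0(\mathrm{Var}_K)$ the following holds for all $n\in\mathbb{N}$. If $k>n$ or $k<0$, then $[\mathrm{Sym}^{n,k}]=0$. Further, $[\mathrm{Sym}^{n,0}]=1$, and for $0<k\le n$ the class $[\mathrm{Sym}^{n,k}]$ is the following polynomial in $\mathbb{L}$: $$[\mathrm{Sym}^{n,k}]=\begin{cases}\Big(\prod_{i=1}^{k/2}\frac{\mathbb{L}^{2i}}{\mathbb{L}^{2i}-1}\Big)\Big(\prod_{i=0}^{k-1}(\mathbb{L}^{n-i}-1)\Big) & \text{if } k \text{ is even},\\[4pt] \Big(\prod_{i=1}^{(k-1)/2}\frac{\mathbb{L}^{2i}}{\mathbb{L}^{2i}-1}\Big)\Big(\prod_{i=0}^{k-1}(\mathbb{L}^{n-i}-1)\Big) & \text{if } k \text{ is odd}.\end{cases}$$ Here nothing is inverted in $K_0(\mathrm{Var}_K)$: the right-hand side denotes a polynomial with integer coefficients in $\mathbb{L}$, written as a quotient only for the sake of presentation.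
   Context: $\mathrm{Var}_K$ is the category of $K$-varieties (separated schemes of finite type over $K$). $K_0(\mathrm{Var}_K)$ is the free abelian group on isomorphism classes $[X]$ of $K$-varieties modulo the relations $[X]=[Z]+[X-Z]$ for closed embeddings $Z\hookrightarrow X$, with ring structure induced by the Cartesian product of varieties. $\mathbb{L}:=[\mathbb{A}^1]$. $\mathrm{Sym}^{n,k}$ is the variety of $n\times n$ symmetric matrices over $K$ of rank exactly $k$, a locally closed subvariety of the affine space $\mathbb{A}^{n(n+1)/2}$ of symmetric matrices. *)

(* Defs.v *)
(* K-schemes are represented by their functors of points: a scheme is a Zariski
   sheaf on the category of commutative K-algebras that is covered by open
   affine subfunctors (Demazure-Gabriel, Groupes algebriques, I.1; Jantzen,
   Representations of algebraic groups, I.1). *)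
From Stdlib Require Ring_theory.
From mathcomp Require Import all_boot all_order all_algebra.
From mathcomp Require Import boolp ring zify.
Set Implicit Arguments.
Unset Strict Implicit.
Unset Printing Implicit Defensive.
Import Order.TTheory GRing.Theory Num.Theory.
Local Open Scope ring_scope.

(* Commutative K-algebras, the zero ring included (unlike in comAlgType, which
   would lose the localizations at nilpotent elements). *)
Record kalg (K : fieldType) := KAlg {
  alg_ring :> comPzRingType;
  alg_str : {rmorphism K -> alg_ring} }.

Record khom (K : fieldType) (B C : kalg K) := KHom {
  khom_fun :> {rmorphism B -> C};
  khom_str : forall a : K, khom_fun (alg_str B a) = alg_str C a }.

Definition khom_id (K : fieldType) (B : kalg K) : khom B B :=
  @KHom K B B (idfun : {rmorphism B -> B}) (fun=> erefl).

Lemma khom_comp_str (K : fieldType) (B C D : kalg K) (g : khom C D)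
  (f : khom B C) (a : K) : (g \o f) (alg_str B a) = alg_str D a.
Proof. by rewrite /= !khom_str. Qed.

Definition khom_comp (K : fieldType) (B C D : kalg K) (g : khom C D)
    (f : khom B C) : khom B D :=
  @KHom K B D (g \o f : {rmorphism B -> D}) (khom_comp_str g f).

Inductive ideal_gen (B : comPzRingType) (S : B -> Prop) : B -> Prop :=
| ideal_gen0 : ideal_gen S 0
| ideal_genD (c s x : B) :
    S s -> ideal_gen S x -> ideal_gen S (c * s + x).

(* The morphism Spec C -> Spec B given by phi factors through V(S), resp.
   through its open complement D(S). *)
Definition kills (K : fieldType) (B C : kalg K) (phi : khom B C)
  (S : B -> Prop) : Prop := forall s, S s -> phi s = 0.

Definition unit_ideal (K : fieldType) (B C : kalg K) (phi : khom B C)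
  (S : B -> Prop) : Prop := ideal_gen (fun c => exists2 s, S s & c = phi s) 1.

Definition is_localization (K : fieldType) (B C : kalg K) (f : B)
    (phi : khom B C) : Prop :=
  [/\ exists u : C, phi f * u = 1,
      forall c : C, exists (b : B) (m : nat), c * phi f ^+ m = phi b
    & forall b : B, phi b = 0 -> exists m : nat, f ^+ m * b = 0].

Definition is_field (K : fieldType) (F : kalg K) : Prop :=
  (1 : F) <> 0 /\ forall x : F, x <> 0 -> exists y : F, x * y = 1.

Record kfunctor (K : fieldType) := KFunctor {
  pts :> kalg K -> Type;
  fmap : forall B C : kalg K, khom B C -> pts B -> pts C;
  fmap_id : forall (B : kalg K) (x : pts B), fmap (khom_id B) x = x;
  fmap_comp : forall (B C D : kalg K) (g : khom C D) (f : khom B C)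
    (x : pts B), fmap (khom_comp g f) x = fmap g (fmap f x) }.
Arguments fmap {K} k {B C} _ _.

Record ktrans (K : fieldType) (X Y : kfunctor K) := KTrans {
  ktrans_fun :> forall B : kalg K, X B -> Y B;
  ktrans_nat : forall (B C : kalg K) (phi : khom B C) (x : X B),
    ktrans_fun (fmap X phi x) = fmap Y phi (ktrans_fun x) }.

Definition kiso (K : fieldType) (X Y : kfunctor K) : Prop :=
  exists (f : ktrans X Y) (g : ktrans Y X),
    (forall B, cancel (f B) (g B)) /\ (forall B, cancel (g B) (f B)).

Definition kmono (K : fieldType) (X Y : kfunctor K) (f : ktrans X Y) : Prop :=
  forall B, injective (f B).

Definition kimage (K : fieldType) (X Y : kfunctor K) (f : ktrans X Y)
  (B : kalg K) (y : Y B) : Prop := exists x : X B, f B x = y.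

(* Closed and open subfunctors: their pullback along any Spec B -> X is of the
   form V(S), resp. D(S).  A subset S suffices, as V and D only depend on the
   ideal it generates. *)
Definition closed_sub (K : fieldType) (X : kfunctor K)
    (Z : forall B, X B -> Prop) : Prop :=
  forall (B : kalg K) (x : X B), exists S : B -> Prop,
  forall (C : kalg K) (phi : khom B C), Z C (fmap X phi x) <-> kills phi S.

Definition open_sub (K : fieldType) (X : kfunctor K)
    (U : forall B, X B -> Prop) : Prop :=
  forall (B : kalg K) (x : X B), exists S : B -> Prop,
  forall (C : kalg K) (phi : khom B C),
    U C (fmap X phi x) <-> unit_ideal phi S.

(* Z is a closed subfunctor and U is its open complement X - Z. *)
Definition complementary (K : fieldType) (X : kfunctor K)
    (Z U : forall B, X B -> Prop) : Prop :=
  forall (B : kalg K) (x : X B), exists S : B -> Prop,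
  forall (C : kalg K) (phi : khom B C),
    (Z C (fmap X phi x) <-> kills phi S) /\
    (U C (fmap X phi x) <-> unit_ideal phi S).

Definition closed_immersion (K : fieldType) (Z X : kfunctor K)
  (i : ktrans Z X) : Prop := kmono i /\ closed_sub (@kimage K Z X i).

Definition open_immersion (K : fieldType) (U X : kfunctor K)
  (j : ktrans U X) : Prop := kmono j /\ open_sub (@kimage K U X j).

Section MatrixFunctor.
Context (K : fieldType) (m n : nat).

Lemma mx_fmap_id (B : kalg K) (x : 'M[B]_(m, n)) : map_mx (khom_id B) x = x.
Proof. by apply/matrixP => i j; rewrite mxE. Qed.

Lemma mx_fmap_comp (B C D : kalg K) (g : khom C D) (f : khom B C)
  (x : 'M[B]_(m, n)) : map_mx (khom_comp g f) x = map_mx g (map_mx f x).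
Proof. by apply/matrixP => i j; rewrite !mxE. Qed.

Definition mx_functor : kfunctor K :=
  @KFunctor K (fun B => 'M[B]_(m, n)) (fun B C phi x => map_mx phi x)
    mx_fmap_id mx_fmap_comp.

End MatrixFunctor.

Definition affine_functor (K : fieldType) (n : nat) : kfunctor K :=
  mx_functor K 1 n.

(* The sheaf condition for the covering of Spec B by the D(f i); the algebra
   C i is B_(f i) and D i j is B_(f i * f j). *)
Definition zariski_sheaf (K : fieldType) (X : kfunctor K) : Prop :=
  forall (B : kalg K) (r : nat) (f : 'I_r -> B)
    (C : 'I_r -> kalg K) (D : 'I_r -> 'I_r -> kalg K)
    (l : forall i, khom B (C i))
    (p : forall i j, khom (C i) (D i j)) (q : forall i j, khom (C j) (D i j)),
  (exists a : 'I_r -> B, \sum_i a i * f i = 1) ->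
  (forall i, is_localization (f i) (l i)) ->
  (forall i j, is_localization (f i * f j) (khom_comp (p i j) (l i))) ->
  (forall i j b, p i j (l i b) = q i j (l j b)) ->
  forall x : forall i, X (C i),
  (forall i j, fmap X (p i j) (x i) = fmap X (q i j) (x j)) ->
  exists! y : X B, forall i, fmap X (l i) y = x i.

Definition separated (K : fieldType) (X : kfunctor K) : Prop :=
  forall (B : kalg K) (x y : X B), exists S : B -> Prop,
  forall (C : kalg K) (phi : khom B C),
    fmap X phi x = fmap X phi y <-> kills phi S.

(* A finite covering by open subfunctors isomorphic to closed subschemes of
   affine spaces.  Open subfunctors cover X if they do so on points with values
   in field extensions of K. *)
Definition finite_affine_cover (K : fieldType) (X : kfunctor K) : Prop :=
  exists (I : finType) (W : I -> kfunctor K) (n : I -> nat)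
    (e : forall k, ktrans (W k) (affine_functor K (n k)))
    (j : forall k, ktrans (W k) X),
  [/\ forall k, closed_immersion (e k),
      forall k, open_immersion (j k)
    & forall (F : kalg K) (x : X F), is_field F ->
        exists k, @kimage K (W k) X (j k) F x].

(* Separated schemes of finite type over K. *)
Record variety (K : fieldType) := Variety {
  var_functor :> kfunctor K;
  var_sheaf : zariski_sheaf var_functor;
  var_separated : separated var_functor;
  var_cover : finite_affine_cover var_functor }.

Lemma ideal_gen_sum (B : comPzRingType) (S : B -> Prop) (x y : B) :
  ideal_gen S x -> ideal_gen S y -> ideal_gen S (x + y).
Proof.
elim=> [|c s z Ss _ IH] Sy; first by rewrite add0r.
by rewrite -addrA; apply: ideal_genD => //; apply: IH.
Qed.

Lemma ideal_gen_mul (B : comPzRingType) (S : B -> Prop) (a x : B) :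
  ideal_gen S x -> ideal_gen S (a * x).
Proof.
elim=> [|c s z Ss _ IH]; first by rewrite mulr0; apply: ideal_gen0.
by rewrite mulrDr mulrA; apply: ideal_genD.
Qed.

Lemma ideal_gen_in (B : comPzRingType) (S : B -> Prop) (s : B) :
  S s -> ideal_gen S s.
Proof.
move=> Ss; rewrite -[s]mul1r -[1 * s]addr0.
by apply: ideal_genD => //; apply: ideal_gen0.
Qed.

Lemma ideal_gen_sub (B : comPzRingType) (S T : B -> Prop) :
  (forall s, S s -> ideal_gen T s) -> forall x, ideal_gen S x -> ideal_gen T x.
Proof.
move=> ST x; elim=> [|c s z Ss _ IH]; first exact: ideal_gen0.
by apply: ideal_gen_sum => //; apply/ideal_gen_mul/ST.
Qed.

(* An ideal J containing a power of each f i contains 1 if the f i generate. *)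
Lemma ideal_power_cover (B : comPzRingType) (J : B -> Prop) (r : nat)
    (f : 'I_r -> B) :
  J 0 -> (forall x y, J x -> J y -> J (x + y)) ->
  (forall a x, J x -> J (a * x)) ->
  (exists a : 'I_r -> B, \sum_i a i * f i = 1) ->
  (forall i, exists m, J (f i ^+ m)) -> J 1.
Proof.
move=> J0 JD JM [a fa] fJ.
suff [m]: exists m, J ((\sum_i a i * f i) ^+ m) by rewrite fa expr1n.
apply: (big_ind (fun x => exists m, J (x ^+ m))).
- by exists 1%N; rewrite expr1.
- move=> x y [m Jm] [m' Jm']; exists (m + m')%N; rewrite exprDn.
  apply: big_ind => // -[i lti] _ /=; rewrite -mulr_natl; apply: (JM).
  case: (leqP m' i) => lei.
    by apply: (JM); rewrite -(subnK lei) exprD; apply: (JM).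
  rewrite mulrC; apply: (JM).
  have lem : (m <= m + m' - i)%N by rewrite -addnBA ?leq_addr // ltnW.
  by rewrite -(subnK lem) exprD; apply: (JM).
- move=> i _; have [m Jm] := fJ i; exists m; rewrite exprMn; exact: (JM).
Qed.

Section LocalRings.
Context (K : fieldType) (B : kalg K) (r : nat) (f : 'I_r -> B).
Context (C : 'I_r -> kalg K) (l : forall i, khom B (C i)).
Hypothesis cover : exists a : 'I_r -> B, \sum_i a i * f i = 1.
Hypothesis locl : forall i, is_localization (f i) (l i).

Lemma local_eq0 (b : B) : (forall i, l i b = 0) -> b = 0.
Proof.
move=> b0; rewrite -[b]mul1r.
apply: (@ideal_power_cover B (fun x => x * b = 0) r f) => //=.
- by rewrite mul0r.
- by move=> x y xb yb; rewrite mulrDl xb yb addr0.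
- by move=> a x xb; rewrite -mulrA xb mulr0.
- by move=> i; have [_ _ /(_ _ (b0 i)) [m fb]] := locl i; exists m.
Qed.

Lemma local_eq (b c : B) : (forall i, l i b = l i c) -> b = c.
Proof.
move=> bc; apply/eqP; rewrite -subr_eq0; apply/eqP/local_eq0 => i.
by rewrite rmorphB bc subrr.
Qed.

Lemma local_unit_ideal (S : B -> Prop) :
  (forall i, unit_ideal (l i) S) -> ideal_gen S 1.
Proof.
move=> Si; apply: (@ideal_power_cover B (ideal_gen S) r f) => //.
- exact: ideal_gen0.
- exact: ideal_gen_sum.
- exact: ideal_gen_mul.
move=> i; have [[u fu] frac tors] := locl i.
suff [b [m [Sb /esym bE]]] : exists (b : B) (m : nat),
    ideal_gen S b /\ l i b = 1 * l i (f i) ^+ m.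
  move: bE; rewrite mul1r -rmorphXn => /eqP.
  rewrite -subr_eq0 -rmorphB => /eqP/tors[t /eqP].
  rewrite mulrBr subr_eq0 -exprD => /eqP fE.
  by exists (t + m)%N; rewrite fE; apply: ideal_gen_mul.
elim: (Si i) => [|c _ x [s Ss ->] _ [b [m [Sb bE]]]].
  by exists 0, 0%N; rewrite rmorph0 mul0r; split=> //; apply: ideal_gen0.
have [d [t dE]] := frac c.
exists (f i ^+ m * d * s + f i ^+ t * b), (t + m)%N; split.
  by apply: ideal_genD => //; apply: ideal_gen_mul.
rewrite rmorphD !rmorphM !rmorphXn bE -dE exprD; ring.
Qed.

End LocalRings.

Lemma local_glue (K : fieldType) (B : kalg K) (r : nat) (f : 'I_r -> B)
    (C : 'I_r -> kalg K) (D : 'I_r -> 'I_r -> kalg K)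
    (l : forall i, khom B (C i))
    (p : forall i j, khom (C i) (D i j)) (q : forall i j, khom (C j) (D i j)) :
  (exists a : 'I_r -> B, \sum_i a i * f i = 1) ->
  (forall i, is_localization (f i) (l i)) ->
  (forall i j, is_localization (f i * f j) (khom_comp (p i j) (l i))) ->
  (forall i j b, p i j (l i b) = q i j (l j b)) ->
  forall x : forall i, C i, (forall i j, p i j (x i) = q i j (x j)) ->
  exists y : B, forall i, l i y = x i.
Proof.
move=> cover locl locpl pq x xpq.
suff [y yE] : exists b, forall i, l i b = l i 1 * x i.
  by exists y => i; rewrite yE rmorph1 mul1r.
apply: (@ideal_power_cover B (fun c => exists b, forall i, l i b = l i c * x i)
          r f) => //.
- by exists 0 => i; rewrite rmorph0 mul0r.
- by move=> c d [b bE] [e eE]; exists (b + e) => i; rewrite !rmorphD bE eE mulrDl.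
- by move=> a c [b bE]; exists (a * b) => i; rewrite !rmorphM bE mulrA.
move=> i; have [_ /(_ (x i)) [b [m bE]] _] := locl i.
have ann j : exists s, l j (f i) ^+ s * (x j * l j (f i) ^+ m - l j b) = 0.
  set y := _ - _; have [[u fu] /(_ y) [d [t dE]] _] := locl j.
  have qy : q i j y = 0.
    rewrite rmorphB rmorphM rmorphXn -xpq -!pq -rmorphXn -rmorphM bE.
    by rewrite subrr.
  have [_ _ /(_ d) []] := locpl i j.
    by rewrite /= pq -dE rmorphM qy mul0r.
  move=> s sd; exists s; have := congr1 (l j) sd.
  rewrite rmorph0 rmorphM rmorphXn rmorphM -dE exprMn => E.
  have : (l j (f i) ^+ s * y) * l j (f j) ^+ (s + t) = 0.
    by rewrite -[RHS]E exprD !mulrA; congr (_ * _); rewrite mulrAC.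
  move/(congr1 (fun z => z * u ^+ (s + t))).
  by rewrite mul0r -mulrA -exprMn fu expr1n mulr1.
have [s sP] := choice ann.
exists (\max_j s j + m)%N, (f i ^+ (\max_j s j) * b) => j.
have les : (s j <= \max_j s j)%N by apply: leq_bigmax.
rewrite rmorphM !rmorphXn exprD -mulrA; apply/eqP; rewrite eq_sym -subr_eq0.
rewrite -mulrBr [_ * x j]mulrC -(subnK les) exprD -mulrA sP mulr0.
exact: eqxx.
Qed.

Lemma mx_sheaf (K : fieldType) (m n : nat) : zariski_sheaf (mx_functor K m n).
Proof.
move=> B r f C D l p q cover locl locpl pq x xpq.
have glue i j : exists y, forall k, l k y = x k i j.
  apply: (local_glue cover locl locpl pq) => k k'.
  by have /matrixP/(_ i j) := xpq k k'; rewrite !mxE.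
have [y yP] := choice (fun ij : 'I_m * 'I_n => glue ij.1 ij.2).
exists (\matrix_(i, j) y (i, j)); split=> [k|z zP].
  by apply/matrixP => i j; rewrite !mxE yP.
apply/matrixP => i j; rewrite mxE; apply: (local_eq cover locl) => k.
by rewrite yP -zP mxE.
Qed.

Lemma mx_separated (K : fieldType) (m n : nat) : separated (mx_functor K m n).
Proof.
move=> B x y; exists (fun s => exists i j, s = x i j - y i j) => C phi; split.
  move=> /matrixP xy _ [i [j ->]]; have := xy i j.
  by rewrite !mxE rmorphB => ->; rewrite subrr.
move=> xy; apply/matrixP => i j; rewrite !mxE; apply/eqP; rewrite -subr_eq0.
by rewrite -rmorphB; apply/eqP/xy; exists i, j.
Qed.

Lemma sval_inj (T : Type) (P : T -> Prop) : injective (@sval T P).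
Proof. by move=> [x Px] [y Py]; apply: eq_exist. Qed.

Section SubFunctor.
Context (K : fieldType) (X : kfunctor K) (P : forall B, X B -> Prop).
Hypothesis Pstable : forall (B C : kalg K) (phi : khom B C) (x : X B),
  P x -> P (fmap X phi x).

Definition sub_fmap (B C : kalg K) (phi : khom B C) (x : {x : X B | P x}) :
  {x : X C | P x} := exist _ _ (Pstable phi (proj2_sig x)).

Lemma sub_fmap_id (B : kalg K) (x : {x : X B | P x}) :
  sub_fmap (khom_id B) x = x.
Proof. by apply: sval_inj => /=; rewrite fmap_id. Qed.

Lemma sub_fmap_comp (B C D : kalg K) (g : khom C D) (f : khom B C)
  (x : {x : X B | P x}) :
  sub_fmap (khom_comp g f) x = sub_fmap g (sub_fmap f x).
Proof. by apply: sval_inj => /=; rewrite fmap_comp. Qed.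

Definition sub_functor : kfunctor K :=
  @KFunctor K (fun B => {x : X B | P x}) sub_fmap sub_fmap_id sub_fmap_comp.

Lemma sub_sheaf : zariski_sheaf X ->
  (forall (B : kalg K) r (f : 'I_r -> B) (C : 'I_r -> kalg K)
     (l : forall i, khom B (C i)) (x : X B),
   (exists a : 'I_r -> B, \sum_i a i * f i = 1) ->
   (forall i, is_localization (f i) (l i)) ->
   (forall i, P (fmap X (l i) x)) -> P x) ->
  zariski_sheaf sub_functor.
Proof.
move=> shX Ploc B r f C D l p q cover locl locpl pq x xpq.
have [|y [yx yuniq]] := shX _ _ _ _ _ _ _ _ cover locl locpl pq
  (fun i => sval (x i)).
  by move=> i j; have /(congr1 sval) := xpq i j.
have Py : P y.
  by apply: (Ploc B r f C l y cover locl) => i; rewrite yx; exact: (proj2_sig (x i)).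
exists (exist _ y Py); split=> [i|z zP].
  by apply: sval_inj => /=.
case: z zP => z Pz zP; apply: sval_inj => /=; apply: yuniq => i.
by rewrite -zP.
Qed.

Lemma sub_separated : separated X -> separated sub_functor.
Proof.
move=> sepX B x y; have [S SP] := sepX B (sval x) (sval y); exists S => C phi.
rewrite -SP; split=> [/(congr1 sval) //|xy]; exact: sval_inj.
Qed.

End SubFunctor.

Definition ktrans_id (K : fieldType) (X : kfunctor K) : ktrans X X :=
  @KTrans K X X (fun B x => x) (fun _ _ _ _ => erefl).

Lemma closed_immersion_id (K : fieldType) (X : kfunctor K) :
  closed_immersion (ktrans_id X).
Proof.
split=> [B x y //|B x]; exists (fun=> False) => C phi; split=> _; first by move=> s [].
by exists (fmap X phi x).
Qed.

Lemma open_immersion_id (K : fieldType) (X : kfunctor K) :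
  open_immersion (ktrans_id X).
Proof.
split=> [B x y //|B x]; exists (fun s => s = 1) => C phi; split=> _.
  by apply: ideal_gen_in; exists 1; rewrite ?rmorph1.
by exists (fmap X phi x).
Qed.

Lemma affine_sheaf (K : fieldType) (n : nat) :
  zariski_sheaf (affine_functor K n).
Proof. exact: mx_sheaf. Qed.

Lemma affine_separated (K : fieldType) (n : nat) :
  separated (affine_functor K n).
Proof. exact: mx_separated. Qed.

Lemma affine_cover (K : fieldType) (n : nat) :
  finite_affine_cover (affine_functor K n).
Proof.
exists unit, (fun=> affine_functor K n), (fun=> n), (fun=> ktrans_id _),
  (fun=> ktrans_id _).
split=> [_|_|F x _]; first exact: closed_immersion_id.
  exact: open_immersion_id.
by exists tt, x.
Qed.

Definition affine_space (K : fieldType) (n : nat) : variety K :=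
  Variety (@affine_sheaf K n) (@affine_separated K n) (@affine_cover K n).

Section Product.
Context (K : fieldType) (X Y : kfunctor K).

Definition prod_fmap (B C : kalg K) (phi : khom B C) (x : X B * Y B) :
  X C * Y C := (fmap X phi x.1, fmap Y phi x.2).

Lemma prod_fmap_id (B : kalg K) (x : X B * Y B) : prod_fmap (khom_id B) x = x.
Proof. by case: x => x y; rewrite /prod_fmap /= !fmap_id. Qed.

Lemma prod_fmap_comp (B C D : kalg K) (g : khom C D) (f : khom B C)
  (x : X B * Y B) :
  prod_fmap (khom_comp g f) x = prod_fmap g (prod_fmap f x).
Proof. by rewrite /prod_fmap !fmap_comp. Qed.

Definition prod_functor : kfunctor K :=
  @KFunctor K (fun B => X B * Y B)%type prod_fmap prod_fmap_id prod_fmap_comp.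

Lemma prod_sheaf :
  zariski_sheaf X -> zariski_sheaf Y -> zariski_sheaf prod_functor.
Proof.
move=> shX shY B r f C D l p q cover locl locpl pq x xpq.
have [|y [yx yU]] := shX _ _ _ _ _ _ _ _ cover locl locpl pq
    (fun i => (x i).1).
  by move=> i j; have /(congr1 fst) := xpq i j.
have [|z [zx zU]] := shY _ _ _ _ _ _ _ _ cover locl locpl pq
    (fun i => (x i).2).
  by move=> i j; have /(congr1 snd) := xpq i j.
exists (y, z); split=> [i|[y' z'] yz'].
  by rewrite /= /prod_fmap /= yx zx; case: (x i).
by congr (_, _); [apply: yU | apply: zU] => i; rewrite -yz'.
Qed.

Lemma prod_separated : separated X -> separated Y -> separated prod_functor.
Proof.
move=> sX sY B x y.
have [[S SP] [T TP]] := (sX B x.1 y.1, sY B x.2 y.2).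
exists (fun s => S s \/ T s) => C phi; split.
  by move=> [/SP xy1 /TP xy2] s [/xy1|/xy2].
move=> ST; congr (_, _).
  by apply/SP => s Ss; apply: ST; left.
by apply/TP => s Ts; apply: ST; right.
Qed.

End Product.

Definition prod_trans (K : fieldType) (X X' Y Y' : kfunctor K)
    (f : ktrans X X') (g : ktrans Y Y') :
    ktrans (prod_functor X Y) (prod_functor X' Y').
Proof.
exists (fun B x => (f B x.1, g B x.2)) => B C phi x.
by rewrite /= /prod_fmap !ktrans_nat.
Defined.

Lemma prod_trans_image (K : fieldType) (X X' Y Y' : kfunctor K)
  (f : ktrans X X') (g : ktrans Y Y') (B : kalg K) (x : X' B * Y' B) :
  @kimage K _ _ (prod_trans f g) B x <->
  @kimage K _ _ f B x.1 /\ @kimage K _ _ g B x.2.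
Proof.
case: x => x y; split; first by move=> [[u v] [<- <-]]; split; eexists.
by move=> /= [[u <-] [v <-]]; exists (u, v).
Qed.

Lemma prod_trans_mono (K : fieldType) (X X' Y Y' : kfunctor K)
  (f : ktrans X X') (g : ktrans Y Y') :
  kmono f -> kmono g -> kmono (prod_trans f g).
Proof. by move=> fI gI B [x y] [x' y'] [/fI -> /gI ->]. Qed.

Lemma unit_idealM (K : fieldType) (B C : kalg K) (phi : khom B C)
    (S T : B -> Prop) :
  unit_ideal phi (fun b => exists s t, [/\ S s, T t & b = s * t]) <->
  unit_ideal phi S /\ unit_ideal phi T.
Proof.
split=> [u|[uS uT]].
  split; apply: ideal_gen_sub u => _ [_ [s [t [Ss Tt ->]]] ->].
    rewrite rmorphM mulrC; apply/ideal_gen_mul/ideal_gen_in.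
    by exists s.
  rewrite rmorphM; apply/ideal_gen_mul/ideal_gen_in.
  by exists t.
apply: ideal_gen_sub uS => _ [s Ss ->]; rewrite -[phi s]mulr1.
elim: uT => [|c _ x [t Tt ->] _ IH].
  by rewrite mulr0; apply: ideal_gen0.
rewrite mulrDr; apply: ideal_gen_sum => //.
rewrite mulrCA; apply/ideal_gen_mul/ideal_gen_in.
by exists (s * t); [exists s, t | rewrite rmorphM].
Qed.

Lemma open_immersion_prod (K : fieldType) (X X' Y Y' : kfunctor K)
  (f : ktrans X X') (g : ktrans Y Y') :
  open_immersion f -> open_immersion g -> open_immersion (prod_trans f g).
Proof.
move=> [fI fo] [gI go]; split=> [|B x]; first exact: prod_trans_mono.
have [[S SP] [T TP]] := (fo B x.1, go B x.2).
exists (fun b => exists s t, [/\ S s, T t & b = s * t]) => C phi.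
by rewrite prod_trans_image unit_idealM -SP -TP.
Qed.

Definition prod_affine_trans (K : fieldType) (X Y : kfunctor K) (m n : nat)
    (f : ktrans X (affine_functor K m)) (g : ktrans Y (affine_functor K n)) :
    ktrans (prod_functor X Y) (affine_functor K (m + n)).
Proof.
exists (fun B x => row_mx (f B x.1) (g B x.2)) => B C phi x.
by rewrite /= !ktrans_nat /= map_row_mx.
Defined.

Lemma closed_immersion_prod_affine (K : fieldType) (X Y : kfunctor K)
    (m n : nat)
    (f : ktrans X (affine_functor K m)) (g : ktrans Y (affine_functor K n)) :
  closed_immersion f -> closed_immersion g ->
  closed_immersion (prod_affine_trans f g).
Proof.
move=> [fI fc] [gI gc]; split=> [B [x y] [x' y']|B v].
  by move=> /eq_row_mx[/= /fI -> /gI ->].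
have [[S SP] [T TP]] := (fc B (lsubmx v), gc B (rsubmx v)).
exists (fun s => S s \/ T s) => C phi; split.
  move=> [[x y] /= xy].
  have /SP kS : @kimage K _ _ f C (map_mx phi (lsubmx v)).
    by exists x; rewrite map_lsubmx -xy row_mxKl.
  have /TP kT : @kimage K _ _ g C (map_mx phi (rsubmx v)).
    by exists y; rewrite map_rsubmx -xy row_mxKr.
  by move=> s [/kS|/kT].
move=> ST.
have /SP[x /= xP] : kills phi S by move=> s Ss; apply: ST; left.
have /TP[y /= yP] : kills phi T by move=> s Ts; apply: ST; right.
by exists (x, y); rewrite /= xP yP -map_row_mx hsubmxK.
Qed.

Lemma prod_cover (K : fieldType) (X Y : kfunctor K) :
  finite_affine_cover X -> finite_affine_cover Y ->
  finite_affine_cover (prod_functor X Y).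
Proof.
move=> [I [W [n [e [j [eP jP jX]]]]]] [I' [W' [n' [e' [j' [eP' jP' jY]]]]]].
exists (I * I')%type, (fun k => prod_functor (W k.1) (W' k.2)),
  (fun k => n k.1 + n' k.2)%N, (fun k => prod_affine_trans (e k.1) (e' k.2)),
  (fun k => prod_trans (j k.1) (j' k.2)).
split=> [k|k|F x Ff]; first exact: closed_immersion_prod_affine.
  exact: open_immersion_prod.
have [[k kP] [k' kP']] := (jX F x.1 Ff, jY F x.2 Ff).
by exists (k, k'); apply/prod_trans_image.
Qed.

Definition prod_variety (K : fieldType) (X Y : variety K) : variety K :=
  Variety (prod_sheaf (@var_sheaf K X) (@var_sheaf K Y))
    (prod_separated (@var_separated K X) (@var_separated K Y))
    (prod_cover (@var_cover K X) (@var_cover K Y)).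

Definition point_functor (K : fieldType) : kfunctor K :=
  @KFunctor K (fun=> unit) (fun _ _ _ x => x) (fun _ _ => erefl)
    (fun _ _ _ _ _ _ => erefl).

Lemma point_sheaf (K : fieldType) : zariski_sheaf (point_functor K).
Proof.
move=> B r f C D l p q _ _ _ _ x _.
by exists tt; split=> [i|[] //]; case: (x i).
Qed.

Lemma point_separated (K : fieldType) : separated (point_functor K).
Proof.
move=> B [] []; exists (fun=> False) => C phi.
by split=> // _ s [].
Qed.

Lemma point_cover (K : fieldType) : finite_affine_cover (point_functor K).
Proof.
have nat0 B C (phi : khom B C) (x : point_functor K B) :
  0 = map_mx phi 0 :> 'rV[C]_0 by rewrite map_mx0.
exists unit, (fun=> point_functor K), (fun=> 0%N),
  (fun=> @KTrans K (point_functor K) (affine_functor K 0) (fun _ _ => 0) nat0),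
  (fun=> ktrans_id _).
split=> [_|_|F [] _]; last by exists tt, tt.
  split=> [B [] [] //|B x]; exists (fun=> False) => C phi.
  split=> [_ s []|_]; exists tt; by apply/matrixP => i [].
exact: open_immersion_id.
Qed.

Definition point_variety (K : fieldType) : variety K :=
  Variety (@point_sheaf K) (@point_separated K) (@point_cover K).

(* The minors of A of size larger than k; repeated or permuted rows and columns
   only add zeros and signs.  The empty minor is 1. *)
Definition minor_gt (B : comPzRingType) (n : nat) (k : int) (A : 'M[B]_n)
    (b : B) : Prop :=
  exists (m : nat) (f g : 'I_m -> 'I_n), k < m%:Z /\ b = \det (mxsub f g A).

(* The B-points of Sym^{n,k}: the open complement of the closed subscheme
   rank <= k - 1 in the closed subscheme rank <= k of the affine space of
   symmetric matrices, both being defined by the vanishing of minors.  This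
   scheme is smooth over K, so it is also the reduced subscheme on the set of
   symmetric matrices of rank k. *)
Definition sym_rank (B : comPzRingType) (n : nat) (k : int) (A : 'M[B]_n) :
    Prop :=
  [/\ A^T = A, forall b, minor_gt k A b -> b = 0
    & ideal_gen (minor_gt (k - 1) A) 1].

Lemma minor_gt_map (K : fieldType) (B C : kalg K) (phi : khom B C) (n : nat)
    (k : int) (A : 'M[B]_n) (c : C) :
  minor_gt k (map_mx phi A) c <-> exists2 b, minor_gt k A b & c = phi b.
Proof.
split=> [[m [f [g [km ->]]]]|[_ [m [f [g [km ->]]]] ->]].
  exists (\det (mxsub f g A)); first by exists m, f, g.
  by rewrite -det_map_mx map_mxsub.
by exists m, f, g; rewrite -det_map_mx map_mxsub.
Qed.

Section SymVariety.
Context (K : fieldType) (n : nat) (k : int).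

Lemma sym_stable (B C : kalg K) (phi : khom B C) (A : 'M[B]_n) :
  sym_rank k A -> sym_rank k (map_mx phi A).
Proof.
move=> [symA leA geA]; split=> [|c /minor_gt_map[b Ab ->]|].
- by rewrite map_trmx symA.
- by rewrite (leA _ Ab) rmorph0.
rewrite -(rmorph1 phi); elim: geA => [|c s x Ss _ IH].
  by rewrite rmorph0; apply: ideal_gen0.
rewrite rmorphD rmorphM; apply: ideal_genD => //.
by apply/minor_gt_map; exists s.
Qed.

Definition sym_functor : kfunctor K :=
  @sub_functor K (mx_functor K n n) (fun B => @sym_rank B n k) sym_stable.

Lemma sym_sheaf : zariski_sheaf sym_functor.
Proof.
apply: sub_sheaf; first exact: mx_sheaf.
move=> B r f C l A cover locl lA; split=> [|b Ab|].
- apply/matrixP => i j; apply: (local_eq cover locl) => t.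
  by have [/matrixP/(_ i j)] := lA t; rewrite !mxE.
- apply: (local_eq0 cover locl) => t.
  by have [_ + _] := lA t; apply; apply/minor_gt_map; exists b.
apply: (local_unit_ideal cover locl) => t; have [_ _] := lA t.
by apply: ideal_gen_sub => c /minor_gt_map ?; apply: ideal_gen_in.
Qed.

Lemma sym_separated : separated sym_functor.
Proof. by apply: sub_separated; apply: mx_separated. Qed.

End SymVariety.

(* The open subscheme of Sym^{n,k} where the minor with rows f and columns g
   is invertible, with inverse t. *)
Section SymChart.
Context (K : fieldType) (n k : nat) (f g : 'I_k -> 'I_n).

Definition sym_chart_pt (B : kalg K) (x : 'M[B]_n * 'M[B]_1) : Prop :=
  [/\ x.1^T = x.1, forall b, minor_gt k%:Z x.1 b -> b = 0
    & \det (mxsub f g x.1) * x.2 0 0 = 1].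

Let M := prod_functor (mx_functor K n n) (mx_functor K 1 1).

Lemma sym_chart_stable (B C : kalg K) (phi : khom B C) (x : M B) :
  sym_chart_pt x -> sym_chart_pt (fmap M phi x).
Proof.
case: x => A t [/= symA leA At]; split=> /= [|c /minor_gt_map[b Ab ->]|].
- by rewrite map_trmx symA.
- by rewrite (leA _ Ab) rmorph0.
by rewrite -map_mxsub det_map_mx mxE -rmorphM At rmorph1.
Qed.

Definition sym_chart : kfunctor K := sub_functor sym_chart_stable.

Definition sym_chart_affine : ktrans sym_chart (affine_functor K (n * n + 1)).
Proof.
exists (fun B x => row_mx (mxvec (sval x).1) (sval x).2) => B C phi [x Px] /=.
by rewrite map_row_mx map_mxvec.
Defined.

Lemma sym_chart_closed : closed_immersion sym_chart_affine.
Proof.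
split=> [B x y|B v].
  move=> /eq_row_mx[/(can_inj mxvecK) xy1 xy2]; apply: sval_inj.
  by case: (sval x) (sval y) xy1 xy2 => ? ? [? ?] /= -> ->.
pose A := vec_mx (lsubmx v); pose t := rsubmx v.
exists (fun s => [\/ exists i j, s = A j i - A i j, minor_gt k%:Z A s
  | s = \det (mxsub f g A) * t 0 0 - 1]) => C phi.
have -> : fmap (affine_functor K (n * n + 1)) phi v =
    row_mx (mxvec (map_mx phi A)) (map_mx phi t).
  by rewrite -map_mxvec vec_mxK -map_row_mx hsubmxK.
split=> [[[[A' t'] /= [/= symA leA At]]]|kS].
  move=> /eq_row_mx[/(can_inj mxvecK) AE tE].
  move: symA leA At; rewrite {A'}AE {t'}tE => symA leA At.
  move=> s [[i [j ->]]|As|->].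
  - by move/matrixP/(_ i j): symA; rewrite !mxE rmorphB => ->; rewrite subrr.
  - by apply: leA; apply/minor_gt_map; exists s.
  move: At; rewrite -map_mxsub det_map_mx mxE -rmorphM => At.
  by rewrite rmorphB At rmorph1 subrr.
have P : sym_chart_pt (map_mx phi A, map_mx phi t).
  split=> /= [|c /minor_gt_map[b Ab ->]|].
  - apply/matrixP => i j; rewrite !mxE; apply/eqP; rewrite -subr_eq0.
    by rewrite -rmorphB; apply/eqP/kS/Or31; exists i, j; rewrite !mxE.
  - exact/kS/Or32.
  rewrite -map_mxsub det_map_mx mxE; apply/eqP; rewrite -subr_eq0.
  by rewrite -(rmorph1 phi) -rmorphM -rmorphB; apply/eqP/kS/Or33.
by exists (exist _ _ P).
Qed.

Lemma sym_chart_rank (B : kalg K) (x : M B) :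
  sym_chart_pt x -> sym_rank k%:Z x.1.
Proof.
move=> [symA leA At]; split=> //; rewrite -At mulrC.
apply/ideal_gen_mul/ideal_gen_in; exists k, f, g; split=> //.
by rewrite ltrBlDr ltrDl.
Qed.

Definition sym_chart_incl : ktrans sym_chart (sym_functor K n k%:Z).
Proof.
exists (fun B x => exist _ (sval x).1 (sym_chart_rank (proj2_sig x))).
by move=> B C phi x; apply: sval_inj.
Defined.

Lemma sym_chart_open : open_immersion sym_chart_incl.
Proof.
split=> [B x y /(congr1 sval) /= xy|B [A [symA leA geA]]].
  case: x y xy => [[A t] [/= sA lA At]] [[A' t'] [/= sA' lA' At']] /= AA.
  apply: sval_inj => /=; congr (_, _) => //; apply/matrixP => i j.
  rewrite !ord1 -[LHS]mulr1 -At' -AA mulrCA mulrA At mul1r.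
  by [].
exists (fun s => s = \det (mxsub f g A)) => C phi; split.
  move=> [[[A' t] [/= sA lA At]]] /(congr1 sval) /= AE.
  rewrite /unit_ideal -At mulrC AE -map_mxsub det_map_mx.
  by apply/ideal_gen_mul/ideal_gen_in; exists (\det (mxsub f g A)).
move=> u; have [t At] : exists t, 1 = t * phi (\det (mxsub f g A)).
  elim: u => [|c _ x [_ -> ->] _ [t ->]]; first by exists 0; rewrite mul0r.
  by exists (c + t); rewrite mulrDl.
have P : sym_chart_pt (map_mx phi A, t%:M).
  split=> /= [|c /minor_gt_map[b Ab ->]|].
  - by rewrite map_trmx symA.
  - by rewrite (leA _ Ab) rmorph0.
  by rewrite -map_mxsub det_map_mx mxE eqxx mulr1n mulrC -At.
by exists (exist _ _ P); apply: sval_inj.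
Qed.

End SymChart.

Lemma sym_cover (K : fieldType) (n : nat) (k : int) :
  finite_affine_cover (sym_functor K n k).
Proof.
case: k => k; last first.
  exists void, (of_void _), (of_void _), (fun i : void => match i with end),
    (fun i : void => match i with end).
  split=> [[]|[]|F [A [symA leA geA]] [F1 _]].
  exfalso; apply/F1/leA.
  pose f (i : 'I_0) : 'I_n := False_rect _ (notF (ltn_ord i)).
  by exists 0%N, f, f; rewrite det_mx00.
pose I : finType := ({ffun 'I_k -> 'I_n} * {ffun 'I_k -> 'I_n})%type.
exists I, (fun fg : I => @sym_chart K n k fg.1 fg.2), (fun=> n * n + 1)%N,
  (fun fg : I => @sym_chart_affine K n k fg.1 fg.2),
  (fun fg : I => @sym_chart_incl K n k fg.1 fg.2).
split=> [[f g]|[f g]|F [A [symA leA geA]] [F1 Finv]].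
- exact: sym_chart_closed.
- exact: sym_chart_open.
have [[f [g fg0]]|none] := pselect (exists f g : {ffun 'I_k -> 'I_n},
    \det (mxsub f g A) <> 0).
  have [t At] := Finv _ fg0; exists (f, g).
  have P : @sym_chart_pt K n k f g F (A, t%:M).
    by split=> //=; rewrite mxE eqxx mulr1n.
  by exists (exist _ _ P); apply: sval_inj.
case: F1; elim: geA => // c _ x [m [f [g [km ->]]]] _ ->.
rewrite addr0; suff -> : \det (mxsub f g A) = 0 by rewrite mulr0.
have [/leA -> //|] := pselect (minor_gt k A (\det (mxsub f g A))).
move=> notgt; have mk : m = k.
  apply/eqP; rewrite eqn_leq; apply/andP; split.
    by rewrite leqNgt; apply/negP => km'; case: notgt; exists m, f, g.
  by move: km; rewrite ltrBlDr -[1]/(1%:Z) -PoszD addn1 ltz_nat ltnS.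
subst m.
apply: contrapT => fg0; apply: none; exists (finfun f), (finfun g).
by rewrite mxsub_ffun.
Qed.

Definition sym_variety (K : fieldType) (n : nat) (k : int) : variety K :=
  Variety (@sym_sheaf K n k) (@sym_separated K n k) (@sym_cover K n k).

(* [X] = [Z] + [U] for a closed immersion Z -> X with complement U. *)
Definition scissor (K : fieldType) (X Z U : variety K) : Prop :=
  exists (i : ktrans Z X) (j : ktrans U X),
  [/\ kmono i, kmono j & complementary (@kimage K Z X i) (@kimage K U X j)].

(* Additive expressions in the classes of varieties. *)
Inductive K0_expr (K : fieldType) : Type :=
| K0_gen of variety K
| K0_zeroe
| K0_adde of K0_expr K & K0_expr K
| K0_oppe of K0_expr K.
Arguments K0_zeroe {K}.

(* Equality in the abelian group presented by the isomorphism and scissor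
   relations. *)
Inductive K0_eq (K : fieldType) : K0_expr K -> K0_expr K -> Prop :=
| K0_refl a : K0_eq a a
| K0_sym a b : K0_eq a b -> K0_eq b a
| K0_trans a b c : K0_eq a b -> K0_eq b c -> K0_eq a c
| K0_congD a a' b b' :
    K0_eq a a' -> K0_eq b b' -> K0_eq (K0_adde a b) (K0_adde a' b')
| K0_congN a a' : K0_eq a a' -> K0_eq (K0_oppe a) (K0_oppe a')
| K0_eqA a b c : K0_eq (K0_adde a (K0_adde b c)) (K0_adde (K0_adde a b) c)
| K0_eqC a b : K0_eq (K0_adde a b) (K0_adde b a)
| K0_eq0 a : K0_eq (K0_adde K0_zeroe a) a
| K0_eqN a : K0_eq (K0_adde (K0_oppe a) a) K0_zeroe
| K0_eq_iso (X Y : variety K) : kiso X Y -> K0_eq (K0_gen X) (K0_gen Y)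
| K0_eq_scissor (X Z U : variety K) :
    scissor X Z U -> K0_eq (K0_gen X) (K0_adde (K0_gen Z) (K0_gen U)).

(* The biadditive extension of the product of varieties. *)
Fixpoint K0_scalee (K : fieldType) (X : variety K) (b : K0_expr K) :
    K0_expr K :=
  match b with
  | K0_gen Y => K0_gen (prod_variety X Y)
  | K0_zeroe => K0_zeroe
  | K0_adde b1 b2 => K0_adde (K0_scalee X b1) (K0_scalee X b2)
  | K0_oppe b1 => K0_oppe (K0_scalee X b1)
  end.

Fixpoint K0_mule (K : fieldType) (a b : K0_expr K) : K0_expr K :=
  match a with
  | K0_gen X => K0_scalee X b
  | K0_zeroe => K0_zeroe
  | K0_adde a1 a2 => K0_adde (K0_mule a1 b) (K0_mule a2 b)
  | K0_oppe a1 => K0_oppe (K0_mule a1 b)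
  end.

(* K_0(Var_K): the set of equivalence classes for K0_eq.  It is not declared as
   an instance of the library's ring structures because it lives in a larger
   universe than their carriers (varieties being functors on all K-algebras);
   see K0_ring_theory. *)
Definition K0 (K : fieldType) : Type :=
  {P : K0_expr K -> Prop | exists a, P = K0_eq a}.

Definition K0_pi (K : fieldType) (a : K0_expr K) : K0 K :=
  exist _ (K0_eq a) (ex_intro _ a erefl).

Definition K0_repr (K : fieldType) (x : K0 K) : K0_expr K :=
  sval (cid (proj2_sig x)).

Definition K0_class (K : fieldType) (X : variety K) : K0 K := K0_pi (K0_gen X).
Definition K0_zero (K : fieldType) : K0 K := K0_pi K0_zeroe.
Definition K0_one (K : fieldType) : K0 K := K0_class (point_variety K).
Definition K0_add (K : fieldType) (x y : K0 K) : K0 K :=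
  K0_pi (K0_adde (K0_repr x) (K0_repr y)).
Definition K0_opp (K : fieldType) (x : K0 K) : K0 K :=
  K0_pi (K0_oppe (K0_repr x)).
Definition K0_mul (K : fieldType) (x y : K0 K) : K0 K :=
  K0_pi (K0_mule (K0_repr x) (K0_repr y)).
Arguments K0_zero {K}.
Arguments K0_one {K}.

Definition K0_lefschetz (K : fieldType) : K0 K :=
  K0_class (affine_space K 1).

Definition K0_of_int (K : fieldType) (m : int) : K0 K :=
  match m with
  | Posz p => iter p (K0_add K0_one) K0_zero
  | Negz p => K0_opp (iter p.+1 (K0_add K0_one) K0_zero)
  end.

(* The value of an integer polynomial at x, by the Horner scheme. *)
Definition K0_eval (K : fieldType) (p : {poly int}) (x : K0 K) : K0 K :=
  foldr (fun c v => K0_add (K0_mul v x) (K0_of_int K c)) K0_zero (polyseq p).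

Section K0Theory.
Context (K : fieldType).
Implicit Types (X Y Z : variety K) (a b c : K0_expr K) (x y z : K0 K).

Lemma K0_piP a b : K0_pi a = K0_pi b <-> K0_eq a b.
Proof.
split=> [/(congr1 sval) /= ab|ab]; first by rewrite ab; apply: K0_refl.
apply: sval_inj => /=; apply/funext => c; apply/propext.
by split; apply: K0_trans => //; apply: K0_sym.
Qed.

Lemma K0_reprK x : K0_pi (K0_repr x) = x.
Proof.
by apply: sval_inj; rewrite /= -(svalP (cid (proj2_sig x))).
Qed.

Lemma K0_repr_pi a : K0_eq (K0_repr (K0_pi a)) a.
Proof. by apply/K0_piP; rewrite K0_reprK. Qed.

Lemma K0_piD a b : K0_add (K0_pi a) (K0_pi b) = K0_pi (K0_adde a b).
Proof. by apply/K0_piP/K0_congD; apply: K0_repr_pi. Qed.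

Lemma K0_piN a : K0_opp (K0_pi a) = K0_pi (K0_oppe a).
Proof. by apply/K0_piP/K0_congN/K0_repr_pi. Qed.

Lemma prod_kiso X X' Y Y' : kiso X X' -> kiso Y Y' ->
  kiso (prod_variety X Y) (prod_variety X' Y').
Proof.
move=> [f [f' [fK f'K]]] [g [g' [gK g'K]]].
exists (prod_trans f g), (prod_trans f' g').
by split=> B [x y] /=; rewrite ?fK ?gK ?f'K ?g'K.
Qed.

Lemma prod_kisoC X Y : kiso (prod_variety X Y) (prod_variety Y X).
Proof.
unshelve eexists; first by exists (fun B p => (p.2, p.1)).
unshelve eexists; first by exists (fun B p => (p.2, p.1)).
by split=> B [].
Qed.

Lemma prod_kisoA X Y Z : kiso (prod_variety X (prod_variety Y Z))
  (prod_variety (prod_variety X Y) Z).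
Proof.
unshelve eexists; first by exists (fun B p => (p.1, p.2.1, p.2.2)).
unshelve eexists; first by exists (fun B p => (p.1.1, (p.1.2, p.2))).
by split=> [B [x [y z]]|B [[x y] z]].
Qed.

Lemma prod_kiso1 X : kiso (prod_variety (point_variety K) X) X.
Proof.
unshelve eexists; first by exists (fun B p => p.2).
unshelve eexists; first by exists (fun B t => (tt, t)).
by split=> [B [[] x]|B x].
Qed.

Lemma kiso_refl X : kiso X X.
Proof. by exists (ktrans_id X), (ktrans_id X). Qed.

Lemma prod_scissor X Y Z (U : variety K) : scissor Y Z U ->
  scissor (prod_variety X Y) (prod_variety X Z) (prod_variety X U).
Proof.
move=> [i [j [iI jI ij]]].
exists (prod_trans (ktrans_id X) i), (prod_trans (ktrans_id X) j).
have idI : kmono (ktrans_id X) by move=> B t t'.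
split=> [||B t]; [exact: prod_trans_mono | exact: prod_trans_mono |].
have [S SP] := ij B t.2; exists S => C phi.
have [SZ SU] := SP C phi; split; rewrite prod_trans_image.
  by rewrite -SZ; split=> [[]|] //; split=> //; eexists.
by rewrite -SU; split=> [[]|] //; split=> //; eexists.
Qed.

Lemma K0_scaleeE X b b' :
  K0_eq b b' -> K0_eq (K0_scalee X b) (K0_scalee X b').
Proof.
elim=> /=; try by move=> *; constructor.
- by move=> *; apply: K0_trans; eassumption.
- by move=> Y Y' YY'; apply/K0_eq_iso/prod_kiso => //; apply: kiso_refl.
- by move=> Y Z U YZU; apply/K0_eq_scissor/prod_scissor.
Qed.

Lemma K0_mulrE a b b' : K0_eq b b' -> K0_eq (K0_mule a b) (K0_mule a b').
Proof.
move=> bb'; elim: a => [X||a IHa a' IHa'|a IHa] /=.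
- exact: K0_scaleeE.
- exact: K0_refl.
- exact: K0_congD.
- exact: K0_congN.
Qed.

Lemma K0_addA x y z : K0_add x (K0_add y z) = K0_add (K0_add x y) z.
Proof.
rewrite -[x]K0_reprK -[y]K0_reprK -[z]K0_reprK !K0_piD.
exact/K0_piP/K0_eqA.
Qed.

Lemma K0_addC x y : K0_add x y = K0_add y x.
Proof.
by rewrite -[x]K0_reprK -[y]K0_reprK !K0_piD; apply/K0_piP/K0_eqC.
Qed.

Lemma K0_add0 x : K0_add K0_zero x = x.
Proof. by rewrite -[x]K0_reprK !K0_piD; apply/K0_piP/K0_eq0. Qed.

Lemma K0_addN x : K0_add x (K0_opp x) = K0_zero.
Proof.
by rewrite K0_addC -[x]K0_reprK K0_piN K0_piD; apply/K0_piP/K0_eqN.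
Qed.

Lemma K0_addI x y z : K0_add x y = K0_add x z -> y = z.
Proof.
move/(congr1 (K0_add (K0_opp x))).
by rewrite !K0_addA ![K0_add (K0_opp x) _]K0_addC K0_addN !K0_add0.
Qed.

Lemma K0_oppD x y : K0_opp (K0_add x y) = K0_add (K0_opp x) (K0_opp y).
Proof.
apply: (@K0_addI (K0_add x y)); rewrite K0_addN -K0_addA.
rewrite [K0_add (K0_opp x) _]K0_addC [K0_add y _]K0_addA K0_addN.
by rewrite K0_add0 K0_addN.
Qed.

Lemma K0_opp0 : K0_opp K0_zero = K0_zero :> K0 K.
Proof. by rewrite -[LHS]K0_add0 K0_addN. Qed.

Lemma K0_addACA x y z t :
  K0_add (K0_add x y) (K0_add z t) = K0_add (K0_add x z) (K0_add y t).
Proof.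
by rewrite -!K0_addA; congr K0_add; rewrite !K0_addA [K0_add y z]K0_addC.
Qed.

Lemma K0_muleC a b : K0_eq (K0_mule a b) (K0_mule b a).
Proof.
apply/K0_piP; elim: a => [X||a IHa a' IHa'|a IHa] /=.
- elim: b => [Y||b IHb b' IHb'|b IHb] //=.
  + exact/K0_piP/K0_eq_iso/prod_kisoC.
  + by rewrite -!K0_piD IHb IHb'.
  + by rewrite -!K0_piN IHb.
- elim: b => [Y||b IHb b' IHb'|b IHb] //=.
  + by rewrite -K0_piD -IHb -IHb' K0_add0.
  + by rewrite -K0_piN -IHb K0_opp0.
- rewrite -K0_piD IHa IHa' => {IHa IHa'}.
  elim: b => [Y||b IHb b' IHb'|b IHb] /=; rewrite ?K0_piD //.
  + exact/K0_piP/K0_eq0.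
  + by rewrite -!K0_piD -IHb -IHb' K0_addACA.
  + by rewrite -K0_piD -!K0_piN -IHb K0_oppD.
- rewrite -K0_piN IHa => {IHa}.
  elim: b => [Y||b IHb b' IHb'|b IHb] /=; rewrite ?K0_piN //.
  + by rewrite -K0_piN K0_opp0.
  + by rewrite -K0_piN -!K0_piD -IHb -IHb' K0_oppD.
  + by rewrite -!K0_piN -IHb.
Qed.

Lemma K0_piM a b : K0_mul (K0_pi a) (K0_pi b) = K0_pi (K0_mule a b).
Proof.
apply/K0_piP; apply: K0_trans (K0_mulrE _ (K0_repr_pi b)) _.
apply: K0_trans (K0_muleC _ _) _.
apply: K0_trans (K0_mulrE _ (K0_repr_pi a)) _.
exact: K0_muleC.
Qed.

Lemma K0_mulC x y : K0_mul x y = K0_mul y x.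
Proof.
by rewrite -[x]K0_reprK -[y]K0_reprK !K0_piM; apply/K0_piP/K0_muleC.
Qed.

Lemma K0_mulDl x y z :
  K0_mul (K0_add x y) z = K0_add (K0_mul x z) (K0_mul y z).
Proof.
by rewrite -[x]K0_reprK -[y]K0_reprK -[z]K0_reprK !(K0_piD, K0_piM).
Qed.

Lemma K0_mulNl x y : K0_mul (K0_opp x) y = K0_opp (K0_mul x y).
Proof. by rewrite -[x]K0_reprK -[y]K0_reprK !(K0_piN, K0_piM). Qed.

Lemma K0_mul0 x : K0_mul K0_zero x = K0_zero.
Proof. by rewrite -[x]K0_reprK !K0_piM. Qed.

Lemma K0_mul1 x : K0_mul K0_one x = x.
Proof.
rewrite -[x]K0_reprK K0_piM; elim: (K0_repr x) => [X||a IHa a' IHa'|a IHa] //=.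
- exact/K0_piP/K0_eq_iso/prod_kiso1.
- by rewrite -!K0_piD IHa IHa'.
- by rewrite -!K0_piN IHa.
Qed.

Lemma K0_classM X Y :
  K0_class (prod_variety X Y) = K0_mul (K0_class X) (K0_class Y).
Proof. by rewrite K0_piM. Qed.

Lemma K0_mulA x y z : K0_mul x (K0_mul y z) = K0_mul (K0_mul x y) z.
Proof.
have mulDr (u v w : K0 K) :
    K0_mul u (K0_add v w) = K0_add (K0_mul u v) (K0_mul u w).
  by rewrite K0_mulC K0_mulDl (K0_mulC u v) (K0_mulC u w).
have mulNr (u v : K0 K) : K0_mul u (K0_opp v) = K0_opp (K0_mul u v).
  by rewrite K0_mulC K0_mulNl (K0_mulC u v).
have mulr0 (u : K0 K) : K0_mul u K0_zero = K0_zero by rewrite K0_mulC K0_mul0.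
rewrite -[x]K0_reprK; elim: (K0_repr x) => [X||a IHa a' IHa'|a IHa].
- rewrite -[y]K0_reprK; elim: (K0_repr y) => [Y||a IHa a' IHa'|a IHa].
  + rewrite -[z]K0_reprK; elim: (K0_repr z) => [Z||a IHa a' IHa'|a IHa].
    * by rewrite -!K0_classM; apply/K0_piP/K0_eq_iso/prod_kisoA.
    * by rewrite !mulr0.
    * by rewrite -K0_piD !mulDr IHa IHa'.
    * by rewrite -K0_piN !mulNr IHa.
  + by rewrite K0_mul0 mulr0 K0_mul0.
  + by rewrite -K0_piD K0_mulDl !mulDr K0_mulDl IHa IHa'.
  + by rewrite -K0_piN K0_mulNl !mulNr K0_mulNl IHa.
- by rewrite !K0_mul0.
- by rewrite -K0_piD !K0_mulDl IHa IHa'.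
- by rewrite -K0_piN !K0_mulNl IHa.
Qed.

End K0Theory.

Lemma K0_ring_theory (K : fieldType) :
  Ring_theory.ring_theory (@K0_zero K) K0_one (@K0_add K) (@K0_mul K)
    (fun x y => K0_add x (K0_opp y)) (@K0_opp K) eq.
Proof.
constructor=> //.
- exact: K0_add0.
- exact: K0_addC.
- exact: K0_addA.
- exact: K0_mul1.
- exact: K0_mulC.
- exact: K0_mulA.
- exact: K0_mulDl.
- exact: K0_addN.
Qed.

(* Over a field sym_rank is the usual rank condition. *)
Lemma sym_rank_field (F : fieldType) (n : nat) (k : int) (A : 'M[F]_n) :
  sym_rank k A <-> A^T = A /\ (\rank A)%:Z = k.
Proof.
have minor_rank m (f g : 'I_m -> 'I_n) :
    \det (mxsub f g A) <> 0 -> (m <= \rank A)%N.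
  move=> /eqP; rewrite -unitfE -unitmxE => /mxrank_unit <-.
  rewrite mxsubrc; apply: leq_trans (mxrankS (rowsub_sub _ _)) _.
  by rewrite -mxrank_tr trmx_mxsub -(mxrank_tr A); apply/mxrankS/rowsub_sub.
have [f [g fg0]] : exists f g : 'I_(\rank A) -> 'I_n, \det (mxsub f g A) <> 0.
  set f := maxrankfun A.
  have fullA : row_full (rowsub f A)^T.
    by rewrite /row_full mxrank_tr eq_maxrowsub.
  exists f, (fullrankfun fullA); apply/eqP; rewrite -unitfE -unitmxE.
  rewrite -unitmx_tr.
  have -> : (mxsub f (fullrankfun fullA) A)^T =
      rowsub (fullrankfun fullA) (rowsub f A)^T.
    by apply/matrixP => i j; rewrite !mxE.
  exact: fullrowsub_unit.
split=> [[symA leA geA]|[symA <-]].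
  split=> //; apply/eqP; rewrite eq_le; apply/andP; split.
    rewrite leNgt; apply/negP => kr; apply/fg0/leA.
    by exists (\rank A), f, g.
  rewrite leNgt; apply/negP => rk; move: (oner_neq0 F) => /eqP; apply.
  elim: geA => // c _ x [m [f' [g' [km ->]]]] _ ->; rewrite addr0.
  have [->|/minor_rank mr] := pselect (\det (mxsub f' g' A) = 0).
    by rewrite mulr0.
  by lia.
split=> // [_ [m [f' [g' [rm ->]]]]|].
  apply: contrapT => /minor_rank; rewrite leqNgt => /negP; apply.
  by rewrite -ltz_nat.
have <- : (\det (mxsub f g A))^-1 * \det (mxsub f g A) = 1.
  by apply: mulVf; apply/eqP.
apply/ideal_gen_mul/ideal_gen_in.
by exists (\rank A), f, g; split=> //; rewrite ltrBlDr ltrDl.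
Qed.

(* Main.v *)
(* Stratify Sym^{n+1,k} by the position of the first nonzero entry of the first
   row.  If it is the diagonal entry a, then a is an invertible 1x1 pivot, and
   taking the Schur complement identifies the stratum with
   G_m x A^n x Sym^{n,k-1}.  If it is the entry c in column j > 0, then moving
   column j to column 1 makes [[0, c], [c, d]] an invertible 2x2 pivot, and the
   stratum is G_m x A^1 x A^{n-j} x A^{n-1} x Sym^{n-1,k-2}.  If the first row is
   zero, what remains is Sym^{n,k}.  Since these are isomorphisms of functors,
   valid over every K-algebra, they give
     [Sym^{n+1,k}] = (L - 1) L^n [Sym^{n,k-1}] + [Sym^{n,k}]
                     + (L^n - 1) L^n [Sym^{n-1,k-2}],
   a recurrence also satisfied by the closed formula.  Over a ring the rank is
   encoded by ideals of minors, which only depend on the matrix up to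
   multiplication by invertible matrices on either side. *)
From HB Require Import structures.
Require Import Defs.
From mathcomp Require Import all_boot all_order all_algebra perm.
From mathcomp Require Import boolp zify ring.
Set Implicit Arguments.
Unset Strict Implicit.
Unset Printing Implicit Defensive.
Import Order.TTheory GRing.Theory Num.Theory.
Local Open Scope ring_scope.

(** * Ideals of minors *)

Section Minors.
Context (B : comPzRingType).

(** Vanishing of this ideal says that the rank is at most [k], and [1] lying in it that the rank
    exceeds [k] at every point. Ideals, unlike single minors, absorb the linear combinations
    produced by matrix multiplication. *)
Definition minor_ideal (n : nat) (k : int) (A : 'M[B]_n) : B -> Prop :=
  ideal_gen (minor_gt k A).

Lemma minor_gt_mxsub (n m : nat) (k : int) (A : 'M[B]_n) (f g : 'I_m -> 'I_n) :
  k < m%:Z -> minor_ideal k A (\det (mxsub f g A)).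
Proof. by move=> km; apply: ideal_gen_in; exists m, f, g. Qed.

Lemma minor_ideal_sum (n : nat) (k : int) (A : 'M[B]_n) (I : finType)
    (F : I -> B) :
  (forall i, minor_ideal k A (F i)) -> minor_ideal k A (\sum_i F i).
Proof.
move=> AF; apply: (big_ind (minor_ideal k A)) => //; first exact: ideal_gen0.
exact: ideal_gen_sum.
Qed.

Lemma minor_ideal_sub (n n' : nat) (k k' : int) (A : 'M[B]_n) (A' : 'M[B]_n') :
  (forall (m : nat) (f g : 'I_m -> 'I_n), k < m%:Z ->
     minor_ideal k' A' (\det (mxsub f g A))) ->
  forall b, minor_ideal k A b -> minor_ideal k' A' b.
Proof.
by move=> AA' b; apply: ideal_gen_sub => _ [m [f [g [km ->]]]]; apply: AA'.
Qed.

(** Multilinearity of the determinant in the rows: the Cauchy-Binet expansion before grouping, with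
    a sum over all index functions [h], so that no signs or orderings enter. *)
Lemma det_mulmx_expand (m n : nat) (P : 'M[B]_(m, n)) (A : 'M[B]_(n, m)) :
  \det (P *m A) =
  \sum_(h : {ffun 'I_m -> 'I_n}) (\prod_i P i (h i)) * \det (rowsub h A).
Proof.
rewrite /determinant.
under eq_bigr => s _.
  under eq_bigr => i _ do rewrite mxE.
  rewrite bigA_distr_bigA /= mulr_sumr.
  under eq_bigr => h _ do rewrite big_split.
  over.
rewrite exchange_big; apply: eq_bigr => h _.
rewrite mulr_sumr; apply: eq_bigr => s _.
by rewrite mulrCA; congr (_ * (_ * _)); apply: eq_bigr => i _; rewrite mxE.
Qed.

(** The determinant is expanded along the rows for [P], then, after transposing, along the columns
    for [Q]. Applied to a pair of inverse transformations this gives equality of ideals; rectangular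
    factors also allow the size to change. *)
Lemma minor_ideal_mulmx (n n' : nat) (k : int) (P : 'M[B]_(n', n))
    (A : 'M[B]_n) (Q : 'M[B]_(n, n')) (b : B) :
  minor_ideal k (P *m A *m Q) b -> minor_ideal k A b.
Proof.
apply: minor_ideal_sub => m f g km; rewrite -mulmxA mxsub_mul.
rewrite det_mulmx_expand; apply: minor_ideal_sum => h; apply: ideal_gen_mul.
have -> : rowsub h (colsub g (A *m Q)) =
    ((colsub g Q)^T *m (rowsub h A)^T)^T.
  by rewrite trmx_mul !trmxK -mxsub_mul; apply/matrixP => i j; rewrite !mxE.
rewrite det_tr det_mulmx_expand; apply: minor_ideal_sum => h'.
apply: ideal_gen_mul.
have -> : rowsub h' (rowsub h A)^T = (mxsub h h' A)^T.
  by apply/matrixP => i j; rewrite !mxE.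
by rewrite det_tr; apply: minor_gt_mxsub.
Qed.

Lemma minor_ideal_mxsub (n n' : nat) (k : int) (A : 'M[B]_n)
    (s t : 'I_n' -> 'I_n) (b : B) :
  minor_ideal k (mxsub s t A) b -> minor_ideal k A b.
Proof.
apply: minor_ideal_sub => m f g km; rewrite -mxsub_comp.
exact: minor_gt_mxsub.
Qed.

Lemma det_mxsub_ninj (m n : nat) (A : 'M[B]_n) (f g : 'I_m -> 'I_n) :
  ~ (injective f /\ injective g) -> \det (mxsub f g A) = 0.
Proof.
have ninj p q (C : 'M[B]_n) : ~ injective p -> \det (mxsub p q C : 'M_m) = 0.
  move=> pI; apply: contrapT => C0; apply: pI => i j pij.
  apply/eqP/negP => /negP ij; apply: C0.
  by apply: (determinant_alternate ij) => l; rewrite !mxE pij.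
move=> /not_andP[] fI; first exact: ninj.
by rewrite -det_tr trmx_mxsub ninj.
Qed.

Lemma det_mxsub_gt (m n : nat) (A : 'M[B]_n) (f g : 'I_m -> 'I_n) :
  (n < m)%N -> \det (mxsub f g A) = 0.
Proof.
move=> nm; apply: det_mxsub_ninj => -[fI _].
by have := leq_card f fI; rewrite !card_ord leqNgt nm.
Qed.

Lemma lift0_fun (m n : nat) (f : 'I_m -> 'I_n.+1) :
  (forall i, f i != ord0) -> exists f', forall i, f i = lift ord0 (f' i).
Proof.
move=> f0; have f1 i : exists j, f i = lift ord0 j.
  by case: (unliftP ord0 (f i)) (f0 i) => [j ->|->]; [exists j|rewrite eqxx].
by have [f' f'E] := choice f1; exists f'.
Qed.

(** Here [A] is the direct sum of [1] and a block [D]. A minor through row 0 expands along it to a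
    minor of [D] smaller by one, a minor through column 0 alone has a zero column, and any other
    minor is a minor of [D]. Conversely a minor of [D] bordered by the pivot is a minor of [A]. *)
Lemma minor_ideal_unit_pivot (n : nat) (k : int) (A : 'M[B]_n.+1) :
  (forall j, A ord0 j = (j == ord0)%:R) ->
  (forall i, A i ord0 = (i == ord0)%:R) ->
  forall b, minor_ideal k A b <->
    minor_ideal (k - 1) (mxsub (lift ord0) (lift ord0) A) b.
Proof.
move=> Ar Ac b; set D := mxsub _ _ A; split; apply: minor_ideal_sub => m f g km.
  (* Injectivity ensures that no second copy of row or column 0 is left once the pivot has been
     removed. *)
  have [fgI|/det_mxsub_ninj ->] := pselect (injective f /\ injective g);
    last exact: ideal_gen0.
  case: fgI => fI gI.
  have lift_minor m' (f' g' : 'I_m' -> 'I_n.+1) : k - 1 < m'%:Z ->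
      (forall i, f' i != ord0) -> (forall i, g' i != ord0) ->
      minor_ideal (k - 1) D (\det (mxsub f' g' A)).
    move=> km' /lift0_fun[f0 f0E] /lift0_fun[g0 g0E].
    have -> : mxsub f' g' A = mxsub f0 g0 D.
      by apply/matrixP => i j; rewrite !mxE f0E g0E.
    exact: minor_gt_mxsub.
  case: (pickP (fun i => f i == ord0)) => [i /eqP fi|f0].
    rewrite (expand_det_row _ i); apply: minor_ideal_sum => j.
    rewrite mxE fi Ar; have [gj|_] := eqVneq (g j) ord0; last first.
      by rewrite mul0r; apply: ideal_gen0.
    apply: ideal_gen_mul; rewrite /cofactor; apply: ideal_gen_mul.
    have -> : row' i (col' j (mxsub f g A)) = mxsub (f \o lift i) (g \o lift j) A.
      by apply/matrixP => x y; rewrite !mxE.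
    apply: lift_minor => [|x|x] /=.
    - by case: m i {j gj fi f g fI gI} km => [[]|] //=; lia.
    - by rewrite -fi (inj_eq fI) eq_sym neq_lift.
    - by rewrite -gj (inj_eq gI) eq_sym neq_lift.
  case: (pickP (fun i => g i == ord0)) => [j /eqP gj|g0].
    rewrite (expand_det_col _ j) big1 => [|i _]; first exact: ideal_gen0.
    by rewrite mxE gj Ac f0 mul0r.
  apply: lift_minor => [|i|i]; rewrite ?f0 ?g0 //; lia.
(* [ext h] puts the pivot index in front of the indices chosen by [h]. *)
pose ext (h : 'I_m -> 'I_n) (i : 'I_m.+1) :=
  if unlift ord0 i is Some j then lift ord0 (h j) else ord0.
have -> : \det (mxsub f g D) = \det (mxsub (ext f) (ext g) A).
  rewrite (expand_det_row _ ord0) big_ord_recl big1 ?addr0 => [|j _].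
    rewrite mxE /ext unlift_none Ar eqxx mul1r /cofactor expr0 mul1r.
    by congr (\det _); apply/matrixP => i j; rewrite !mxE !liftK.
  by rewrite mxE /ext unlift_none Ar liftK mul0r.
by apply: minor_gt_mxsub; lia.
Qed.

Lemma minor_ideal_block1 (h n : nat) (k : int) (D : 'M[B]_n) (b : B) :
  minor_ideal k (block_mx (1%:M : 'M_h) 0 0 D) b <-> minor_ideal (k - h%:Z) D b.
Proof.
elim: h k => [|h IH] k.
  have -> : block_mx (1%:M : 'M_0) 0 0 D = D.
    (* For an empty identity block, [rshift 0] is the identity on indices. *)
    apply/matrixP => i j; rewrite -[i in LHS](_ : rshift 0 i = i); last exact: val_inj.
    rewrite -[j in LHS](_ : rshift 0 j = j); last exact: val_inj.
    by rewrite block_mxEdr.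
  by rewrite subr0.
have -> : k - h.+1%:Z = k - 1 - h%:Z by lia.
set A := block_mx _ _ _ _.
have Aul (i j : 'I_h.+1) : A (lshift n i) (lshift n j) = (i == j)%:R.
  by rewrite /A block_mxEul mxE.
have Aur (i : 'I_h.+1) (j : 'I_n) : A (lshift n i) (rshift h.+1 j) = 0.
  by rewrite /A block_mxEur mxE.
have Adl (i : 'I_n) (j : 'I_h.+1) : A (rshift h.+1 i) (lshift n j) = 0.
  by rewrite /A block_mxEdl mxE.
have ord0E : ord0 = lshift n ord0 :> 'I_(h.+1 + n) by apply: val_inj.
rewrite -IH (@minor_ideal_unit_pivot (h + n) k A); first last.
- move=> i; rewrite ord0E; case: (@split_ordP h.+1 n i) => i' ->.
    by rewrite Aul -!val_eqE.
  by rewrite Adl -val_eqE.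
- move=> i; rewrite ord0E; case: (@split_ordP h.+1 n i) => i' ->.
    by rewrite Aul -!val_eqE eq_sym.
  by rewrite Aur -val_eqE.
suff -> : mxsub (lift ord0) (lift ord0) A = block_mx 1%:M 0 0 D by [].
have liftl (i : 'I_h) : lift ord0 (lshift n i) = lshift n (lift ord0 i) :> 'I_(h.+1 + n).
  exact: val_inj.
have liftr (i : 'I_n) : lift ord0 (rshift h i) = rshift h.+1 i.
  exact: val_inj.
have Adr (i j : 'I_n) : A (rshift h.+1 i) (rshift h.+1 j) = D i j.
  by rewrite /A block_mxEdr.
apply/matrixP => i j; rewrite mxE.
case: (split_ordP i) => i' ->; case: (split_ordP j) => j' ->;
  rewrite ?liftl ?liftr ?Aul ?Aur ?Adl ?Adr.
- by rewrite block_mxEul mxE (inj_eq (@lift_inj _ _)).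
- by rewrite block_mxEur mxE.
- by rewrite block_mxEdl mxE.
- by rewrite block_mxEdr.
Qed.

(** Block elimination: the matrix factors as an invertible lower triangular block matrix, the direct
    sum of the identity and the Schur complement [S], and a unipotent upper triangular one.
    Inverting the outer factors gives the other direction. *)
Lemma minor_ideal_schur (h n : nat) (k : int) (H H' : 'M[B]_h)
    (V : 'M[B]_(h, n)) (W : 'M[B]_(n, h)) (S : 'M[B]_n) (b : B) :
  H *m H' = 1%:M -> H' *m H = 1%:M ->
  minor_ideal k (block_mx H V W (S + W *m H' *m V)) b <->
  minor_ideal (k - h%:Z) S b.
Proof.
move=> HH' H'H; rewrite -minor_ideal_block1; split.
  have -> : block_mx H V W (S + W *m H' *m V) =
      block_mx H 0 W 1%:M *m block_mx 1%:M 0 0 S *m block_mx 1%:M (H' *m V) 0 1%:M.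
    rewrite !mulmx_block !(mulmx0, mul0mx, mulmx1, mul1mx, addr0, add0r).
    by rewrite !mulmxA HH' mul1mx addrC.
  exact: minor_ideal_mulmx.
have -> : block_mx 1%:M 0 0 S =
    block_mx H' 0 (- (W *m H')) 1%:M *m block_mx H V W (S + W *m H' *m V)
      *m block_mx 1%:M (- (H' *m V)) 0 1%:M.
  rewrite !mulmx_block !(mulmx0, mul0mx, mulmx1, mul1mx, addr0, add0r).
  rewrite !mulNmx -!mulmxA H'H mulmx1 addNr mul0mx add0r.
  rewrite [_ + (S + _)]addrCA addNr addr0.
  by rewrite [H' *m (H *m _)]mulmxA H'H mul1mx addNr.
exact: minor_ideal_mulmx.
Qed.

Lemma minor_ideal_corner (h n : nat) (k : int) (D : 'M[B]_n) (b : B) :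
  minor_ideal k (block_mx (0 : 'M_h) 0 0 D) b <-> minor_ideal k D b.
Proof.
split.
  have -> : block_mx (0 : 'M_h) 0 0 D = col_mx 0 1%:M *m D *m row_mx 0 1%:M.
    by rewrite mul_col_mx mul_col_row !(mul0mx, mulmx0, mul1mx, mulmx1).
  exact: minor_ideal_mulmx.
have {1}-> : D = mxsub (@rshift h n) (@rshift h n) (block_mx 0 0 0 D).
  by rewrite -drsubmxEsub block_mxKdr.
exact: minor_ideal_mxsub.
Qed.

Lemma sym_rankE (n : nat) (k : int) (A : 'M[B]_n) :
  sym_rank k A <->
  [/\ A^T = A, forall b, minor_ideal k A b -> b = 0 & minor_ideal (k - 1) A 1].
Proof.
split=> -[symA leA geA]; split=> // b Ab; last exact/leA/ideal_gen_in.
by elim: Ab => // c s x /leA -> _ ->; rewrite mulr0 addr0.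
Qed.

Lemma sym_rank_minor_ideal (n n' : nat) (k k' : int) (A : 'M[B]_n)
    (A' : 'M[B]_n') :
  (A^T = A <-> A'^T = A') ->
  (forall b, minor_ideal k A b <-> minor_ideal k' A' b) ->
  (forall b, minor_ideal (k - 1) A b <-> minor_ideal (k' - 1) A' b) ->
  sym_rank k A <-> sym_rank k' A'.
Proof.
move=> symA leA geA; rewrite !sym_rankE; split=> -[/symA sA A0 /geA A1].
  by split=> // b /leA; apply: A0.
by split=> // b /leA; apply: A0.
Qed.

(** The term [R^T *m H' *m R] is symmetric because the inverse of a symmetric matrix is, so the
    whole matrix is symmetric exactly when [S] is; the ranks differ by the size [h] of the pivot. *)
Lemma sym_rank_schur (h n : nat) (k : int) (H H' : 'M[B]_h)
    (R : 'M[B]_(h, n)) (S : 'M[B]_n) :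
  H^T = H -> H *m H' = 1%:M ->
  sym_rank k (block_mx H R R^T (S + R^T *m H' *m R)) <->
  sym_rank (k - h%:Z) S.
Proof.
move=> symH HH'.
(* Transposing turns the right inverse of the symmetric [H] into a left inverse, and the two
   coincide. *)
have H'tH : H'^T *m H = 1%:M by rewrite -{1}symH -trmx_mul HH' trmx1.
have symH' : H'^T = H' by rewrite -[RHS]mul1mx -H'tH -mulmxA HH' mulmx1.
have H'H : H' *m H = 1%:M by rewrite -{1}symH'.
apply: sym_rank_minor_ideal => [|b|b]; last 2 first.
- exact: minor_ideal_schur.
- rewrite (_ : k - h%:Z - 1 = k - 1 - h%:Z); last by rewrite addrAC.
  exact: minor_ideal_schur.
rewrite tr_block_mx symH trmxK linearD /= !trmx_mul trmxK symH' mulmxA.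
split=> [/eq_block_mx[_ _ _ /addIr] //|-> //].
Qed.

Lemma sym_rank_corner (h n : nat) (k : int) (D : 'M[B]_n) :
  sym_rank k (block_mx (0 : 'M_h) 0 0 D) <-> sym_rank k D.
Proof.
apply: sym_rank_minor_ideal => [|b|b]; try exact: minor_ideal_corner.
by rewrite tr_block_mx !trmx0; split=> [/eq_block_mx[_ _ _] //|->].
Qed.

Lemma sym_rank_mxsub (n : nat) (k : int) (A : 'M[B]_n) (s : 'I_n -> 'I_n) :
  involutive s -> sym_rank k (mxsub s s A) <-> sym_rank k A.
Proof.
move=> sK; have ssA : mxsub s s (mxsub s s A) = A.
  by apply/matrixP => i j; rewrite !mxE !sK.
have ideal_s k' b : minor_ideal k' (mxsub s s A) b <-> minor_ideal k' A b.
  split; first exact: minor_ideal_mxsub.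
  by rewrite -{1}ssA; apply: minor_ideal_mxsub.
apply: sym_rank_minor_ideal => //; rewrite trmx_mxsub.
by split=> [/(congr1 (mxsub s s))|->] //; rewrite ssA => {1}<-;
  apply/matrixP => i j; rewrite !mxE !sK.
Qed.

(** The empty minor is [1] and has size larger than [k]. The conclusion is [1 = 0] rather than
    absurdity because the zero ring is an allowed algebra. *)
Lemma sym_rank_lt0 (n : nat) (k : int) (A : 'M[B]_n) :
  k < 0 -> sym_rank k A -> (1 : B) = 0.
Proof.
move=> k0 [_ leA _]; apply: leA; exists 0%N.
by exists (fun i : 'I_0 => False_rect _ (notF (ltn_ord i))),
  (fun i : 'I_0 => False_rect _ (notF (ltn_ord i))); rewrite det_mx00.
Qed.

(** The minors that should generate the unit ideal have more than [n] rows, so they all vanish. *)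
Lemma sym_rank_gt (n : nat) (k : int) (A : 'M[B]_n) :
  n%:Z < k -> sym_rank k A -> (1 : B) = 0.
Proof.
move=> nk [_ _]; elim=> // c _ x [m [f [g [km ->]]]] _ ->.
by rewrite det_mxsub_gt ?mulr0 ?addr0 //; lia.
Qed.

Lemma sym_rank_dim0 (A : 'M[B]_0) : sym_rank 0 A.
Proof.
split=> [|b [m [f [g [m0 ->]]]]|].
- by apply/matrixP => -[].
- by rewrite det_mxsub_gt //; lia.
- by rewrite -(det_mx00 (mxsub id id A)); apply: ideal_gen_in; exists 0%N, id, id.
Qed.

End Minors.

(** * Closed subvarieties *)

Section QuotientRing.
Context (B : comPzRingType) (S : B -> Prop).
Local Open Scope quotient_scope.

(** Congruence modulo the ideal is turned into a boolean classically, as the quotient construction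
    takes a boolean equivalence relation. *)
Definition ideal_equiv (x y : B) : bool := `[< ideal_gen S (x - y) >].

Lemma ideal_equiv_refl : reflexive ideal_equiv.
Proof. by move=> x; apply/asboolP; rewrite subrr; apply: ideal_gen0. Qed.

Lemma ideal_equiv_sym : symmetric ideal_equiv.
Proof.
suff sym x y : ideal_equiv x y -> ideal_equiv y x.
  by move=> x y; apply/idP/idP; apply: sym.
move=> /asboolP Sxy; apply/asboolP; rewrite -opprB -mulN1r.
exact: ideal_gen_mul.
Qed.

Lemma ideal_equiv_trans : transitive ideal_equiv.
Proof.
move=> y x z /asboolP Sxy /asboolP Syz; apply/asboolP.
by rewrite -(subrKA y); apply: ideal_gen_sum.
Qed.

Canonical ideal_equiv_rel :=
  EquivRel ideal_equiv ideal_equiv_refl ideal_equiv_sym ideal_equiv_trans.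

Definition ideal_quot := {eq_quot ideal_equiv_rel}.

HB.instance Definition _ := Choice.on ideal_quot.
HB.instance Definition _ := EqQuotient.on ideal_quot.

Definition ideal_pi (x : B) : ideal_quot := \pi_ideal_quot x.

Lemma ideal_quotP (x y : B) :
  ideal_pi x = ideal_pi y <-> ideal_gen S (x - y).
Proof.
by split=> [/eqquotP/asboolP //|Sxy]; apply/eqquotP/asboolP.
Qed.

Lemma ideal_quot_repr (x : B) : ideal_gen S (repr (ideal_pi x) - x).
Proof. by apply/ideal_quotP; rewrite /ideal_pi reprK. Qed.

Definition ideal_quot_add (x y : ideal_quot) : ideal_quot :=
  ideal_pi (repr x + repr y).
Definition ideal_quot_mul (x y : ideal_quot) : ideal_quot :=
  ideal_pi (repr x * repr y).
Definition ideal_quot_opp (x : ideal_quot) : ideal_quot := ideal_pi (- repr x).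

Lemma ideal_quot_piD (x y : B) :
  ideal_quot_add (ideal_pi x) (ideal_pi y) = ideal_pi (x + y).
Proof.
apply/ideal_quotP; rewrite opprD addrACA.
by apply: ideal_gen_sum; apply: ideal_quot_repr.
Qed.

Lemma ideal_quot_piN (x : B) : ideal_quot_opp (ideal_pi x) = ideal_pi (- x).
Proof.
apply/ideal_quotP; rewrite -opprD -mulN1r; apply: ideal_gen_mul.
exact: ideal_quot_repr.
Qed.

Lemma ideal_quot_piM (x y : B) :
  ideal_quot_mul (ideal_pi x) (ideal_pi y) = ideal_pi (x * y).
Proof.
apply/ideal_quotP; set a := repr _; rewrite -(subrKA (a * y)) -mulrBr -mulrBl.
apply: ideal_gen_sum; first exact/ideal_gen_mul/ideal_quot_repr.
by rewrite mulrC; apply/ideal_gen_mul/ideal_quot_repr.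
Qed.

Lemma ideal_quot_ind (P : ideal_quot -> Prop) :
  (forall x, P (ideal_pi x)) -> forall x, P x.
Proof. by move=> Ppi x; rewrite -[x]reprK; apply: Ppi. Qed.

Lemma ideal_quot_addA : associative ideal_quot_add.
Proof.
elim/ideal_quot_ind => x; elim/ideal_quot_ind => y; elim/ideal_quot_ind => z.
by rewrite !ideal_quot_piD addrA.
Qed.

Lemma ideal_quot_addC : commutative ideal_quot_add.
Proof.
elim/ideal_quot_ind => x; elim/ideal_quot_ind => y.
by rewrite !ideal_quot_piD addrC.
Qed.

Lemma ideal_quot_add0 : left_id (ideal_pi 0) ideal_quot_add.
Proof. by elim/ideal_quot_ind => x; rewrite ideal_quot_piD add0r. Qed.

Lemma ideal_quot_addN : left_inverse (ideal_pi 0) ideal_quot_opp ideal_quot_add.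
Proof.
by elim/ideal_quot_ind => x; rewrite ideal_quot_piN ideal_quot_piD addNr.
Qed.

HB.instance Definition _ := GRing.isZmodule.Build ideal_quot
  ideal_quot_addA ideal_quot_addC ideal_quot_add0 ideal_quot_addN.

Lemma ideal_quot_mulA : associative ideal_quot_mul.
Proof.
elim/ideal_quot_ind => x; elim/ideal_quot_ind => y; elim/ideal_quot_ind => z.
by rewrite !ideal_quot_piM mulrA.
Qed.

Lemma ideal_quot_mulC : commutative ideal_quot_mul.
Proof.
elim/ideal_quot_ind => x; elim/ideal_quot_ind => y.
by rewrite !ideal_quot_piM mulrC.
Qed.

Lemma ideal_quot_mul1 : left_id (ideal_pi 1) ideal_quot_mul.
Proof. by elim/ideal_quot_ind => x; rewrite ideal_quot_piM mul1r. Qed.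

Lemma ideal_quot_mulD : left_distributive ideal_quot_mul ideal_quot_add.
Proof.
elim/ideal_quot_ind => x; elim/ideal_quot_ind => y; elim/ideal_quot_ind => z.
by rewrite ideal_quot_piD !ideal_quot_piM ideal_quot_piD mulrDl.
Qed.

HB.instance Definition _ := GRing.Zmodule_isComPzRing.Build ideal_quot
  ideal_quot_mulA ideal_quot_mulC ideal_quot_mul1 ideal_quot_mulD.

Lemma ideal_pi_zmod_morphism : zmod_morphism ideal_pi.
Proof.
move=> x y; apply/esym; rewrite -ideal_quot_piD -ideal_quot_piN; reflexivity.
Qed.

Lemma ideal_pi_monoid_morphism : monoid_morphism ideal_pi.
Proof. by split=> // x y; rewrite [RHS]ideal_quot_piM. Qed.

HB.instance Definition _ :=
  GRing.isZmodMorphism.Build B ideal_quot ideal_pi ideal_pi_zmod_morphism.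
HB.instance Definition _ :=
  GRing.isMonoidMorphism.Build B ideal_quot ideal_pi ideal_pi_monoid_morphism.

End QuotientRing.

Lemma khom_ext (K : fieldType) (B C : kalg K) (f g : khom B C) :
  f =1 g -> f = g.
Proof.
case: f g => [[f [[f0] [f1]]] fS] [[g [[g0] [g1]]] gS] /= /funext fg.
move: f0 f1 fS g0 g1 gS; rewrite fg => f0 f1 fS g0 g1 gS.
move: fS; rewrite (Prop_irrelevance f0 g0) (Prop_irrelevance f1 g1) => fS.
by congr KHom; apply: Prop_irrelevance.
Qed.

Section QuotientAlgebra.
Context (K : fieldType) (B : kalg K) (S : B -> Prop).

Definition quot_kalg : kalg K :=
  KAlg (ideal_pi S \o alg_str B : {rmorphism K -> ideal_quot S}).

Definition quot_pi : khom B quot_kalg :=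
  @KHom K B quot_kalg (ideal_pi S : {rmorphism B -> ideal_quot S})
    (fun=> erefl).

Lemma quot_pi_surj (x : quot_kalg) : exists b, x = quot_pi b.
Proof. by elim/ideal_quot_ind: x => b; exists b. Qed.

Lemma quot_pi_kills : kills quot_pi S.
Proof.
move=> s Ss; apply/ideal_quotP; rewrite subr0; exact: ideal_gen_in.
Qed.

(** Universal property of the quotient: [phi] kills the whole ideal generated by [S], so its value
    on the chosen representative of a class depends on the class only. *)
Lemma quot_lift (C : kalg K) (phi : khom B C) :
  kills phi S -> exists psi : khom quot_kalg C, khom_comp psi quot_pi = phi.
Proof.
move=> phiS; have phi0 b : ideal_gen S b -> phi b = 0.
  elim=> [|c s x /phiS s0 _ x0]; first by rewrite rmorph0.
  by rewrite rmorphD rmorphM s0 x0 mulr0 addr0.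
pose f (x : ideal_quot S) : C := phi (repr x).
have fpi b : f (ideal_pi S b) = phi b.
  apply/eqP; rewrite -subr_eq0 -rmorphB; apply/eqP/phi0; exact: ideal_quot_repr.
have fB : zmod_morphism f.
  elim/ideal_quot_ind => x; elim/ideal_quot_ind => y.
  by rewrite -[_ - _](rmorphB (ideal_pi S)) !fpi rmorphB.
have fM : monoid_morphism f.
  split; first by rewrite -(rmorph1 (ideal_pi S)) fpi rmorph1.
  elim/ideal_quot_ind => x; elim/ideal_quot_ind => y.
  by rewrite -[_ * _](rmorphM (ideal_pi S)) !fpi rmorphM.
pose mf := GRing.isZmodMorphism.Build _ _ f fB.
pose mm := GRing.isMonoidMorphism.Build _ _ f fM.
pose F : {rmorphism ideal_quot S -> C} := HB.pack f mf mm.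
have Fstr a : F (alg_str quot_kalg a) = alg_str C a.
  by rewrite [LHS]fpi khom_str.
exists (@KHom K quot_kalg C F Fstr); exact: khom_ext.
Qed.

End QuotientAlgebra.

(** * Closed subfunctors of varieties as varieties *)

Section ClosedVariety.
Context (K : fieldType) (X : variety K) (P : forall B : kalg K, X B -> Prop).
Hypothesis Pstable : forall (B C : kalg K) (phi : khom B C) (x : X B),
  P x -> P (fmap X phi x).
Hypothesis Pclosed : closed_sub P.

Let Z : kfunctor K := sub_functor Pstable.

(** A closed condition is the vanishing of some elements of [B], and an element that vanishes in
    every localization of a covering is zero. *)
Lemma closed_sub_sheaf : zariski_sheaf Z.
Proof.
apply: sub_sheaf (@var_sheaf K X) _ => B r f C l x cover locl lx.
have [S SP] := Pclosed x; rewrite -(fmap_id x); apply/SP => s Ss.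
by apply: (local_eq0 cover locl) => i; have /SP := lx i; apply.
Qed.

(* The ideal cutting out [P] on the chart [W k] only lives over the coordinate
   ring of [W k], i.e. over the quotient [quot_kalg S1]. *)
Lemma closed_sub_cover : finite_affine_cover Z.
Proof.
have [I [W [n [e [j [eP jP jX]]]]]] := @var_cover K X.
pose Q k (B : kalg K) (w : W k B) := P (j k B w).
have Qs k (B C : kalg K) (phi : khom B C) (w : W k B) :
  Q k B w -> Q k C (fmap (W k) phi w) by rewrite /Q ktrans_nat; apply: Pstable.
have enat k (B C : kalg K) (phi : khom B C) (w : sub_functor (Qs k) B) :
  e k C (sval (fmap (sub_functor (Qs k)) phi w)) =
  fmap (affine_functor K (n k)) phi (e k B (sval w)) by rewrite -ktrans_nat.
pose j' k (B : kalg K) (w : sub_functor (Qs k) B) : Z B :=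
  exist _ (j k B (sval w)) (svalP w).
have jnat k (B C : kalg K) (phi : khom B C) (w : sub_functor (Qs k) B) :
  j' k C (fmap (sub_functor (Qs k)) phi w) = fmap Z phi (j' k B w).
  by apply: sval_inj; rewrite /= ktrans_nat.
exists I, (fun k => sub_functor (Qs k)), n, (fun k => KTrans (enat k)),
  (fun k => KTrans (jnat k)).
split=> [k|k|F x Ff].
- have [eI ec] := eP k; split=> [B x y /eI /sval_inj //|B v].
  have [S1 S1P] := ec B v.
  (* [w] is the tautological point: every point of [W k] lying over a pullback of [v] is an image of
     [w]. *)
  have [w wE] : kimage (e k) (fmap (affine_functor K (n k)) (quot_pi S1) v).
    by apply/S1P/quot_pi_kills.
  have [S2 S2P] := Pclosed (j k _ w).
  have psiE (C : kalg K) (phi : khom B C) psi :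
      khom_comp psi (quot_pi S1) = phi ->
      e k C (fmap (W k) psi w) = fmap (affine_functor K (n k)) phi v.
    by move=> <-; rewrite ktrans_nat wE fmap_comp.
  (* The equations of [W k] in affine space, together with lifts to [B] of the equations of [P] at
     [w]. *)
  exists (fun b => S1 b \/ S2 (quot_pi S1 b)) => C phi; split.
    move=> [[w' Pw'] /= w'E].
    have /S1P phiS1 : kimage (e k) (fmap (affine_functor K (n k)) phi v).
      by exists w'.
    have [psi psiP] := quot_lift phiS1.
    have /S2P psiS2 : P (fmap X psi (j k _ w)).
      by rewrite -ktrans_nat (_ : fmap _ psi w = w') //; apply: eI; rewrite w'E; apply: psiE.
    by move=> s [/phiS1 //|/psiS2]; rewrite -psiP.
  move=> phiS.
  have phiS1 : kills phi S1 by move=> s ?; apply: phiS; left.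
  have [psi psiP] := quot_lift phiS1.
  have Pw : P (j k C (fmap (W k) psi w)).
    rewrite ktrans_nat; apply/S2P => x; have [b ->] := quot_pi_surj x => Sb.
    by rewrite -[LHS]/(khom_comp psi (quot_pi S1) b) psiP; apply: phiS; right.
  by exists (exist _ (fmap (W k) psi w) Pw); apply: psiE.
- have [jI jo] := jP k; split=> [B x y /(congr1 sval) /jI /sval_inj //|B x].
  have [S SP] := jo B (sval x); exists S => C phi; rewrite -SP; split.
    by move=> [w /(congr1 sval) /= wE]; exists (sval w).
  move=> [w wE]; have Pw : P (j k C w) by rewrite wE; apply/Pstable/(svalP x).
  by exists (exist _ w Pw); apply: sval_inj.
- have [k [w wE]] := jX F (sval x) Ff.
  have Pw : P (j k F w) by rewrite wE; apply: (svalP x).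
  by exists k, (exist _ w Pw); apply: sval_inj.
Qed.

Definition closed_variety : variety K :=
  Variety closed_sub_sheaf (sub_separated (@var_separated K X))
    closed_sub_cover.

End ClosedVariety.

(** * Classes of varieties *)

Section Classes.
Context (K : fieldType).
Implicit Types X Y Z U : variety K.

Lemma K0_class_kiso X Y : kiso X Y -> K0_class X = K0_class Y.
Proof. by move=> XY; apply/K0_piP/K0_eq_iso. Qed.

(** The pointwise inverse is obtained by choice, and injectivity of [f] makes it natural. *)
Lemma K0_class_bij X Y (f : ktrans X Y) :
  kmono f -> (forall (B : kalg K) (y : Y B), kimage f y) ->
  K0_class X = K0_class Y.
Proof.
move=> fI fS; apply: K0_class_kiso.
pose g (B : kalg K) (y : Y B) : X B := sval (cid (fS B y)).
have gK (B : kalg K) (y : Y B) : f B (g B y) = y := svalP (cid (fS B y)).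
have gnat (B C : kalg K) (phi : khom B C) (y : Y B) :
    g C (fmap Y phi y) = fmap X phi (g B y).
  by apply: fI; rewrite gK ktrans_nat gK.
by exists f, (KTrans gnat); split=> B x //=; apply: fI; rewrite gK.
Qed.

(** The form in which scissor relations are used below: a regular function [t] cuts [X] into its
    zero locus and the open locus where it is invertible. *)
Lemma K0_class_split X Z U (t : forall B : kalg K, X B -> B)
    (i : ktrans Z X) (j : ktrans U X) :
  (forall (B C : kalg K) (phi : khom B C) (x : X B),
     t C (fmap X phi x) = phi (t B x)) ->
  kmono i -> kmono j ->
  (forall (B : kalg K) (x : X B), kimage i x <-> t B x = 0) ->
  (forall (B : kalg K) (x : X B), kimage j x <-> exists u, t B x * u = 1) ->
  K0_class X = K0_add (K0_class Z) (K0_class U).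
Proof.
move=> tnat iI jI iP jP; rewrite [RHS]K0_piD; apply/K0_piP/K0_eq_scissor.
exists i, j; split=> // B x; exists (fun s => s = t B x) => C phi; split.
  rewrite iP tnat; split=> [tx _ ->|] //; exact.
rewrite jP tnat; split=> [[u tu]|].
  by rewrite /unit_ideal -tu mulrC; apply/ideal_gen_mul/ideal_gen_in; exists (t B x).
(* The ideal has one generator, so each of its elements is a multiple of that generator, in
   particular [1]. *)
elim=> [|c _ x' [s -> ->] _ [u <-]]; first by exists 0; rewrite mulr0.
by exists (c + u); rewrite mulrDr [c * _]mulrC.
Qed.

(** Since [X] has points over the zero ring only, the function 0 on it is both zero and invertible.
    Splitting along it gives [[X] = [X] + [X]]. *)
Lemma K0_class_empty X :
  (forall B : kalg K, X B -> (1 : B) = 0) -> K0_class X = K0_zero.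
Proof.
move=> X0; have : K0_class X = K0_add (K0_class X) (K0_class X).
  have idI : kmono (ktrans_id X) by move=> B x y.
  apply: (@K0_class_split X X X (fun B _ => 0) (ktrans_id X) (ktrans_id X)) => //.
  - by move=> B C phi x; rewrite rmorph0.
  - by move=> B x; split=> // _; exists x.
  - move=> B x; split=> _; last by exists x.
    by exists 0; rewrite mulr0 (X0 B x).
rewrite -{1}[K0_class X]K0_add0 K0_addC => /K0_addI; exact: esym.
Qed.

End Classes.

(** * Morphisms into subfunctors *)

Section Lift.
Context (K : fieldType) (X Y : kfunctor K) (P : forall B : kalg K, X B -> Prop).
Context (Pstable : forall (B C : kalg K) (phi : khom B C) (x : X B),
  P x -> P (fmap X phi x)).

Definition sub_val : ktrans (sub_functor Pstable) X :=
  @KTrans K (sub_functor Pstable) X (fun B x => sval x) (fun _ _ _ _ => erefl).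

Context (f : ktrans Y X) (fP : forall (B : kalg K) (y : Y B), P (f B y)).

Lemma sub_lift_nat (B C : kalg K) (phi : khom B C) (y : Y B) :
  exist (@P C) (f C (fmap Y phi y)) (fP (fmap Y phi y)) =
  fmap (sub_functor Pstable) phi (exist _ (f B y) (fP y)).
Proof. by apply: sval_inj; rewrite /= ktrans_nat. Qed.

Definition sub_lift : ktrans Y (sub_functor Pstable) :=
  @KTrans K Y (sub_functor Pstable) (fun B y => exist _ (f B y) (fP y))
    sub_lift_nat.

Lemma sub_lift_mono : kmono f -> kmono sub_lift.
Proof. by move=> fI B x y /(congr1 sval) /fI. Qed.

Lemma sub_lift_image (B : kalg K) (x : sub_functor Pstable B) :
  kimage sub_lift x <-> kimage f (sval x).
Proof.
split=> -[y yx]; exists y; first by rewrite -yx.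
exact: sval_inj.
Qed.

End Lift.

(** * Classes of affine spaces and of the multiplicative group *)

Section Affine.
Context (K : fieldType).

Lemma K0_class_affine0 : K0_class (affine_space K 0) = K0_one.
Proof.
have nat0 (B C : kalg K) (phi : khom B C) (x : affine_space K 0 B) :
  tt = fmap (point_variety K) phi tt by [].
pose f := @KTrans K (affine_space K 0) (point_variety K) (fun B _ => tt) nat0.
apply: (K0_class_bij (f := f)) => [B x y _|B []].
  by apply/matrixP => i [].
by exists 0.
Qed.

Lemma K0_class_affineS (n : nat) :
  K0_class (affine_space K n.+1) =
  K0_mul (K0_class (affine_space K 1)) (K0_class (affine_space K n)).
Proof.
pose X := prod_variety (affine_space K 1) (affine_space K n).
have f_nat (B C : kalg K) (phi : khom B C) (x : X B) :
    row_mx (fmap X phi x).1 (fmap X phi x).2 =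
    fmap (affine_space K n.+1) phi (row_mx x.1 x.2).
  exact: esym (map_row_mx phi x.1 x.2).
rewrite -K0_classM; apply: esym.
pose f := @KTrans K X (affine_space K n.+1) (fun B x => row_mx x.1 x.2) f_nat.
apply: (K0_class_bij (f := f)).
  by move=> B [x1 x2] [y1 y2] /(@eq_row_mx _ 1 1 n)[/= -> ->].
by move=> B v; exists (@lsubmx _ 1 1 n v, @rsubmx _ 1 1 n v); exact: (@hsubmxK _ 1 1 n v).
Qed.

(** The multiplicative group is realized as the hyperbola [xy = 1], which is closed in the plane, so
    that it is a closed subvariety. *)
Definition unit_pair (B : kalg K) (x : 'rV[B]_1 * 'rV[B]_1) : Prop :=
  x.1 *m x.2 = 1%:M.

Let A2 := prod_variety (affine_space K 1) (affine_space K 1).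

Lemma unit_pair_stable (B C : kalg K) (phi : khom B C) (x : A2 B) :
  unit_pair x -> unit_pair (fmap A2 phi x).
Proof. by rewrite /unit_pair /= -map_mxM => ->; rewrite map_mx1. Qed.

Lemma mx11P (B : pzSemiRingType) (x y : 'M[B]_1) : x = y <-> x 0 0 = y 0 0.
Proof. by split=> [->|xy] //; apply/matrixP => i j; rewrite !ord1. Qed.

Lemma mulmx11 (B : pzSemiRingType) (x y : 'M[B]_1) : (x *m y) 0 0 = x 0 0 * y 0 0.
Proof. by rewrite mxE big_ord1. Qed.

Lemma unit_pair_closed : @closed_sub K A2 unit_pair.
Proof.
move=> B x; exists (fun s => s = x.1 0 0 * x.2 0 0 - 1) => C phi.
rewrite /unit_pair mx11P mulmx11 !mxE eqxx; split.
  by move=> x1 _ ->; rewrite rmorphB rmorphM rmorph1 x1 subrr.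
move=> /(_ _ erefl) /eqP; rewrite rmorphB rmorphM rmorph1 subr_eq0.
by move/eqP.
Qed.

Definition Gm : variety K := closed_variety unit_pair_stable unit_pair_closed.

Definition Gm_val : ktrans Gm (affine_space K 1) :=
  @KTrans K Gm (affine_space K 1) (fun B x => (sval x).1)
    (fun _ _ _ _ => erefl).

Lemma Gm_val_mono : kmono Gm_val.
Proof.
move=> B [[x y] /= xy] [[x' y'] /= xy'] /= xx'; apply: sval_inj => /=.
move: xy xy'; rewrite /unit_pair /= -xx' => xy xy'; congr (_, _).
rewrite -[LHS]mul1mx -xy' -[RHS]mulmx1 -xy.
by apply/mx11P; rewrite !mulmx11 mulrCA mulrA mulrAC.
Qed.

Lemma Gm_val_image (B : kalg K) (x : affine_space K 1 B) :
  kimage Gm_val x <-> exists u, x 0 0 * u = 1.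
Proof.
split=> [[[[y u] /= yu] <-]|[u xu]].
  by exists (u 0 0); rewrite -mulmx11 yu mxE eqxx.
have Pxu : unit_pair (x, u%:M).
  by apply/mx11P; rewrite mulmx11 !mxE eqxx.
by exists (exist _ (x, u%:M) Pxu).
Qed.

(** The coordinate function splits the line into the origin and the multiplicative group. *)
Lemma K0_class_Gm :
  K0_class (affine_space K 1) = K0_add K0_one (K0_class Gm).
Proof.
have i_nat (B C : kalg K) (phi : khom B C) (x : point_variety K B) :
  0 = fmap (affine_space K 1) phi 0 by rewrite /= map_mx0.
pose i := @KTrans K (point_variety K) (affine_space K 1) (fun B _ => 0) i_nat.
pose t (B : kalg K) (x : affine_space K 1 B) : B := x 0 0.
apply: (K0_class_split (Z := point_variety K) (U := Gm) (t := t) (i := i) (j := Gm_val)).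
- by move=> B C phi x; rewrite /t /= mxE.
- by move=> B [] [].
- exact: Gm_val_mono.
- move=> B x; rewrite /t; split=> [[p <-]|x0]; first by rewrite mxE.
  by exists tt; apply/mx11P; rewrite mxE x0.
- exact: Gm_val_image.
Qed.

End Affine.

(** * Strata of the variety of symmetric matrices *)

Section Schur.
Context (K : fieldType) (V : kfunctor K) (h n : nat) (k : int).
Context (H H' : ktrans V (mx_functor K h h)) (R : ktrans V (mx_functor K h n)).
Hypothesis symH : forall (B : kalg K) (v : V B), (H B v)^T = H B v.
Hypothesis invH : forall (B : kalg K) (v : V B), H B v *m H' B v = 1%:M.

Let U := prod_functor V (sym_functor K n (k - h%:Z)).

(** A point of [V] supplies the pivot [H], its inverse [H'] and the block [R] beside it. The last
    block is written so that the Schur complement is the free point of Sym^{n,k-h}. *)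
Definition schur_mx (B : kalg K) (x : U B) : 'M[B]_(h + n) :=
  block_mx (H B x.1) (R B x.1) (R B x.1)^T
    (sval x.2 + (R B x.1)^T *m H' B x.1 *m R B x.1).

Lemma schur_mx_nat (B C : kalg K) (phi : khom B C) (x : U B) :
  schur_mx (fmap U phi x) = map_mx phi (schur_mx x).
Proof.
by rewrite /schur_mx /= !ktrans_nat map_block_mx map_mxD !map_mxM map_trmx.
Qed.

Definition schur_trans : ktrans U (mx_functor K (h + n) (h + n)) :=
  @KTrans K U (mx_functor K (h + n) (h + n)) schur_mx schur_mx_nat.

Lemma schur_trans_rank (B : kalg K) (x : U B) : sym_rank k (schur_trans B x).
Proof. by apply/(sym_rank_schur _ _ _ (symH x.1) (invH x.1))/(svalP x.2). Qed.

Lemma schur_trans_mono :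
  (forall (B : kalg K) (v v' : V B), H B v = H B v' -> R B v = R B v' -> v = v') ->
  kmono schur_trans.
Proof.
move=> HR B [v S] [v' S'] /eq_block_mx[/= Hv Rv _].
rewrite (HR _ _ _ Hv Rv) => /addIr SS'; congr (_, _); exact: sval_inj.
Qed.

(** Symmetry forces the lower left block, so once the upper blocks come from [v] the only remaining
    datum is the Schur complement of [A], which has rank [k - h]. *)
Lemma schur_trans_image (B : kalg K) (A : 'M[B]_(h + n)) (v : V B) :
  sym_rank k A -> ulsubmx A = H B v -> ursubmx A = R B v ->
  kimage schur_trans (A : mx_functor K (h + n) (h + n) B).
Proof.
move=> rA AH AR; pose S := drsubmx A - (R B v)^T *m H' B v *m R B v.
have AE : A = block_mx (H B v) (R B v) (R B v)^T (S + (R B v)^T *m H' B v *m R B v).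
  have [symA _ _] := rA.
  by rewrite subrK -AH -AR trmx_ursub symA submxK.
have rS : sym_rank (k - h%:Z) S.
  by apply/(sym_rank_schur k (R B v) S (symH v) (invH v)); rewrite -AE.
by exists (v, exist _ S rS); exact: esym AE.
Qed.

End Schur.

(** * Stratification by the first nonzero entry of the first row *)

Section Strata.
Context (K : fieldType) (k : int).

(** As [m] grows to [n.+1] these closed conditions lead from all of Sym^{n+1,k} to the matrices with
    zero first row; each open difference is one stratum. *)
Definition row0_zero (n m : nat) (B : kalg K) (A : sym_functor K n.+1 k B) : Prop :=
  forall i : 'I_n.+1, (i < m)%N -> sval A ord0 i = 0.
Arguments row0_zero n m B A : clear implicits.

Lemma row0_zero_stable (n m : nat) (B C : kalg K) (phi : khom B C)
    (A : sym_functor K n.+1 k B) :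
  row0_zero n m B A -> row0_zero n m C (fmap (sym_functor K n.+1 k) phi A).
Proof. by move=> A0 i im; rewrite /= mxE A0 ?rmorph0. Qed.

Lemma row0_zero_closed (n m : nat) :
  @closed_sub K (sym_functor K n.+1 k) (row0_zero n m).
Proof.
move=> B A.
exists (fun s => exists2 i : 'I_n.+1, (i < m)%N & s = sval A ord0 i) => C phi.
split=> [A0 _ [i im ->]|A0 i im]; first by have := A0 i im; rewrite /= mxE.
by rewrite /= mxE A0 //; exists i.
Qed.

Definition sym_row0 (n m : nat) : variety K :=
  closed_variety (X := sym_variety K n.+1 k)
    (@row0_zero_stable n m) (@row0_zero_closed n m).

Lemma K0_class_sym_pivot1 (n : nat) :
  K0_class (sym_variety K n.+1 k) =
  K0_add (K0_class (sym_row0 n 1))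
    (K0_mul (K0_mul (K0_class (Gm K)) (K0_class (affine_space K n)))
       (K0_class (sym_variety K n (k - 1)))).
Proof.
(* The invertible corner entry and the rest of the first row. *)
pose V := prod_variety (Gm K) (affine_space K n).
pose H := @KTrans K V (mx_functor K 1 1) (fun B v => (sval v.1).1)
  (fun _ _ _ _ => erefl).
pose H' := @KTrans K V (mx_functor K 1 1) (fun B v => (sval v.1).2)
  (fun _ _ _ _ => erefl).
pose R := @KTrans K V (mx_functor K 1 n) (fun B v => v.2)
  (fun _ _ _ _ => erefl).
have symH (B : kalg K) (v : V B) : (H B v)^T = H B v.
  by apply/mx11P; rewrite mxE.
have invH (B : kalg K) (v : V B) : H B v *m H' B v = 1%:M by exact: svalP v.1.
pose j : ktrans (prod_variety V (sym_variety K n (k - 1)))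
    (sym_variety K n.+1 k) :=
  @sub_lift K (mx_functor K n.+1 n.+1) _ (fun B => @sym_rank B n.+1 k)
    (@sym_stable K n.+1 k) _ (schur_trans_rank R symH invH).
rewrite -!K0_classM.
pose t (B : kalg K) (A : sym_variety K n.+1 k B) : B := sval A ord0 ord0.
pose i : ktrans (sym_row0 n 1) (sym_variety K n.+1 k) :=
  @sub_val K (sym_functor K n.+1 k) _ (@row0_zero_stable n 1).
apply: (K0_class_split (t := t) (i := i) (j := j)).
- by move=> B C phi A; rewrite /t /= mxE.
- by move=> B x y /sval_inj.
- apply/sub_lift_mono/schur_trans_mono => B [g v] [g' v'] /= gg' ->.
  by congr (_, _); apply: Gm_val_mono.
- move=> B A; split=> [[A' <-]|A0]; first exact: (svalP A').
  have PA : row0_zero n 1 B A.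
    move=> l; rewrite ltnS leqn0 => /eqP l0.
    by rewrite (_ : l = ord0) //; apply: val_inj.
  by exists (exist _ A PA).
- move=> B A; rewrite sub_lift_image /t; split=> [[[g S] /= <-]|[u Au]].
    have ord0E : ord0 = lshift n ord0 :> 'I_(1 + n) by apply: val_inj.
    have -> : schur_mx H H' R (g, S) ord0 ord0 = (sval g.1).1 0 0.
      by rewrite ord0E; apply: block_mxEul.
    by exists ((sval g.1).2 0 0); rewrite -mulmx11 (svalP g.1) mxE.
  pose A' : 'M_(1 + n) := sval A.
  have [g gA] : kimage (Gm_val K) (ulsubmx A' : affine_space K 1 B).
    apply/Gm_val_image; exists u; rewrite -Au; congr (_ * _).
    by rewrite !mxE; congr (sval A _ _); apply: val_inj.
  exact: (@schur_trans_image _ _ _ _ _ H H' R symH invH B A'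
    (g, ursubmx A') (svalP A) (esym gA)).
Qed.

(** By symmetry a zero first row comes with a zero first column, and the remaining block is an
    arbitrary point of Sym^{n,k}. *)
Lemma K0_class_sym_row0_all (n : nat) :
  K0_class (sym_row0 n n.+1) = K0_class (sym_variety K n k).
Proof.
pose M n := mx_functor K n n.
have f_nat (B C : kalg K) (phi : khom B C) (D : sym_variety K n k B) :
    block_mx (0 : 'M_1) 0 0 (map_mx phi (sval D)) =
    map_mx phi (block_mx 0 0 0 (sval D)).
  by rewrite map_block_mx !map_mx0.
pose f := @KTrans K (sym_variety K n k) (M n.+1)
  (fun B D => block_mx (0 : 'M_1) 0 0 (sval D)) f_nat.
have f_rank (B : kalg K) (D : sym_variety K n k B) : sym_rank k (f B D).
  exact: (proj2 (sym_rank_corner 1 k (sval D)) (svalP D)).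
pose f1 : ktrans _ (sym_functor K n.+1 k) :=
  @sub_lift K (M n.+1) _ (fun B => @sym_rank B n.+1 k) (@sym_stable K n.+1 k)
    f f_rank.
have f_row0 (B : kalg K) (D : sym_variety K n k B) : row0_zero n n.+1 B (f1 B D).
  move=> i _; rewrite /= (_ : ord0 = lshift n ord0 :> 'I_(1 + n)); last exact: val_inj.
  case: (@split_ordP 1 n i) => i' ->.
    by apply: etrans (block_mxEul _ _ _ _ _ _) _; rewrite mxE.
  by apply: etrans (block_mxEur _ _ _ _ _ _) _; rewrite mxE.
pose f2 : ktrans (sym_variety K n k) (sym_row0 n n.+1) :=
  @sub_lift K (sym_functor K n.+1 k) _ (row0_zero n n.+1)
    (@row0_zero_stable n n.+1) f1 f_row0.
apply/esym/(K0_class_bij (f := f2)).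
  do 2!apply: sub_lift_mono; move=> B D D' /(@eq_block_mx _ 1 n 1 n)[_ _ _].
  exact: sval_inj.
move=> B [A A0]; apply/sub_lift_image/sub_lift_image => /=.
have [symA _ _] := svalP A; pose A' : 'M_(1 + n) := sval A.
have AE : A' = block_mx 0 0 0 (drsubmx A').
  have ur0 : ursubmx A' = 0.
    apply/matrixP => i j; rewrite !mxE -[RHS](A0 (rshift 1 j) (ltn_ord _)).
    by rewrite ord1; congr (sval A _ _); apply: val_inj.
  rewrite -[LHS]submxK; congr block_mx => //.
    apply/matrixP => i j; rewrite !mxE -[RHS](A0 ord0 isT) !ord1.
    by congr (sval A _ _); apply: val_inj.
  by rewrite -[LHS]trmxK trmx_dlsub (symA : A'^T = A') ur0 trmx0.
have rD : sym_rank k (drsubmx A').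
  by apply/(sym_rank_corner 1); rewrite -AE; apply: svalP A.
by exists (exist _ (drsubmx A') rD); apply: esym AE.
Qed.

(** The swap [s] brings column [m.+1] to position 1. The zeros in columns 0 to [m] then sit at
    position 0 and at the [m] positions following the 2x2 pivot. *)
Lemma row0_zero_tperm (m q : nat) (B : kalg K) (A : 'M[B]_((m + q).+2))
    (s := tperm (inord 1 : 'I_((m + q).+2)) (inord m.+1)) :
  (forall i : 'I_((m + q).+2), (i < m.+1)%N -> A ord0 i = 0) <->
  A ord0 ord0 = 0 /\
  forall i : 'I_m, A ord0 (s (rshift 2 (lshift q i))) = 0.
Proof.
(* With the values of [s] explicit, the index bounds are linear arithmetic; for [m = 0] the two
   swapped indices coincide. *)
have s_eq (i : 'I_((m + q).+2)) : s i = (if i == 1%N :> nat then m.+1 else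
    if i == m.+1 :> nat then 1 else i)%N :> nat.
  have m1 : (inord m.+1 : 'I_((m + q).+2)) = m.+1 :> nat by rewrite inordK //; lia.
  have v1 : (inord 1 : 'I_((m + q).+2)) = 1%N :> nat by rewrite inordK.
  rewrite /s; case: tpermP => [->|->|/eqP i1 /eqP im].
  - by rewrite m1 v1 eqxx.
  - by rewrite m1 v1 eqxx; case: eqP.
  by move: i1 im; rewrite -!val_eqE /= m1 v1 => /negbTE -> /negbTE ->.
split=> [A0|[A00 A0] i im].
  split=> [|i]; apply: A0 => //; rewrite s_eq /=; have := ltn_ord i.
  by do ?case: ifP; lia.
have [i0|i0] := eqVneq (val i) 0%N; first by rewrite (_ : i = ord0) //; apply: val_inj.
have sil : (s i - 2 < m)%N.
  by rewrite s_eq; move: i0 => /=; do ?case: ifP; lia.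
rewrite -[RHS](A0 (Ordinal sil)); congr (A _ _).
rewrite -[LHS](tpermK (inord 1) (inord m.+1)) -/s; congr (s _).
by apply: val_inj; rewrite /= s_eq; move: i0 => /=; do ?case: ifP; lia.
Qed.

(** The splitting function is the entry [c] in column [m.+1] of the first row. Where it is
    invertible, the pivot is [[0, c], [c, d]] after the swap, and [q] counts the columns to the
    right of [c]. *)
Lemma K0_class_sym_pivot2 (m q : nat) :
  K0_class (sym_row0 (m + q).+1 m.+1) =
  K0_add (K0_class (sym_row0 (m + q).+1 m.+2))
    (K0_mul
       (K0_mul (K0_mul (K0_class (Gm K)) (K0_class (affine_space K 1)))
          (K0_mul (K0_class (affine_space K q))
             (K0_class (affine_space K (m + q)))))
       (K0_class (sym_variety K (m + q) (k - 2)))).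
Proof.
set n := (m + q)%N.
(* In order: [c], the diagonal entry [d], the [q] free entries of the first row, and the second row
   outside the pivot. *)
pose V := prod_variety (prod_variety (Gm K) (affine_space K 1))
  (prod_variety (affine_space K q) (affine_space K n)).
pose g (B : kalg K) (v : V B) : 'M[B]_1 := (sval v.1.1).1.
pose g' (B : kalg K) (v : V B) : 'M[B]_1 := (sval v.1.1).2.
pose d (B : kalg K) (v : V B) : 'M[B]_1 := v.1.2.
have gg' (B : kalg K) (v : V B) : g B v *m g' B v = 1%:M by exact: svalP v.1.1.
have H_nat (B C : kalg K) (phi : khom B C) (v : V B) :
    block_mx 0 (g C (fmap V phi v)) (g C (fmap V phi v)) (d C (fmap V phi v)) =
    map_mx phi (block_mx 0 (g B v) (g B v) (d B v)).
  by rewrite map_block_mx map_mx0.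
pose H := @KTrans K V (mx_functor K 2 2)
  (fun B v => block_mx 0 (g B v) (g B v) (d B v)) H_nat.
have H'_nat (B C : kalg K) (phi : khom B C) (v : V B) :
    block_mx (- (d C (fmap V phi v) *m g' C (fmap V phi v) *m g' C (fmap V phi v)))
      (g' C (fmap V phi v)) (g' C (fmap V phi v)) 0 =
    map_mx phi (block_mx (- (d B v *m g' B v *m g' B v)) (g' B v) (g' B v) 0).
  by rewrite map_block_mx map_mx0 map_mxN !map_mxM.
(* The inverse of [[0, c], [c, d]] is [[-d/c^2, 1/c], [1/c, 0]]. *)
pose H' := @KTrans K V (mx_functor K 2 2)
  (fun B v => block_mx (- (d B v *m g' B v *m g' B v)) (g' B v) (g' B v) 0)
  H'_nat.
have R_nat (B C : kalg K) (phi : khom B C) (v : V B) :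
    col_mx (row_mx 0 (fmap V phi v).2.1) (fmap V phi v).2.2 =
    map_mx phi (col_mx (row_mx (0 : 'M_(1, m)) v.2.1) v.2.2).
  by rewrite map_col_mx map_row_mx map_mx0.
pose R := @KTrans K V (mx_functor K 2 n)
  (fun B v => col_mx (row_mx (0 : 'M_(1, m)) v.2.1) v.2.2) R_nat.
have tr11 (B : kalg K) (x : 'M[B]_1) : x^T = x by apply/mx11P; rewrite mxE.
have symH (B : kalg K) (v : V B) : (H B v)^T = H B v.
  by rewrite [LHS](tr_block_mx (n1 := 1) (m1 := 1)) trmx0 !tr11.
have invH (B : kalg K) (v : V B) : H B v *m H' B v = 1%:M.
  have g'g : g' B v *m g B v = 1%:M.
    by apply/mx11P; rewrite mulmx11 mulrC -mulmx11 gg'.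
  rewrite [LHS](mulmx_block (m1 := 1) (n1 := 1) (p1 := 1)).
  rewrite !mul0mx !mulmx0 !add0r !addr0 gg' mulmxN !mulmxA.
  rewrite (_ : g B v *m d B v *m g' B v = d B v).
    by rewrite addNr -(scalar_mx_block 1 1).
  by apply/mx11P; rewrite !mulmx11 mulrAC -(mulmx11 (g B v)) gg' mxE eqxx mul1r.
pose s (i : 'I_n.+2) := tperm (inord 1 : 'I_n.+2) (inord m.+1) i.
have sK : involutive s by apply: tpermK.
have ssK (B : kalg K) (A : 'M[B]_n.+2) : mxsub s s (mxsub s s A) = A.
  by apply/matrixP => i j; rewrite !mxE !sK.
pose U := prod_variety V (sym_variety K n (k - 2)).
have f_nat (B C : kalg K) (phi : khom B C) (x : U B) :
    mxsub s s (schur_mx H H' R (fmap U phi x)) =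
    map_mx phi (mxsub s s (schur_mx H H' R x)).
  by rewrite schur_mx_nat map_mxsub.
pose M := mx_functor K n.+2 n.+2.
pose f := @KTrans K U M (fun B x => mxsub s s (schur_mx H H' R x)) f_nat.
have f_rank (B : kalg K) (x : U B) : sym_rank k (f B x).
  by apply/(sym_rank_mxsub _ _ sK)/(@schur_trans_rank K V 2 n k H H' R).
pose f1 : ktrans U (sym_functor K n.+2 k) :=
  @sub_lift K M _ (fun B => @sym_rank B n.+2 k) (@sym_stable K n.+2 k) f f_rank.
have o0 : ord0 = lshift n (lshift 1 (ord0 : 'I_1)) :> 'I_(2 + n).
  exact: val_inj.
have o1 : inord 1 = lshift n (rshift 1 (ord0 : 'I_1)) :> 'I_(2 + n).
  by apply: val_inj; rewrite /= inordK.
have s0 : s ord0 = ord0.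
  by rewrite /s tpermD // -val_eqE /= inordK //; lia.
have sm : s (inord m.+1) = inord 1 by rewrite /s tpermR.
have schur01 (B : kalg K) (x : U B) :
    schur_mx H H' R x ord0 (inord 1) = g B x.1 0 0.
  rewrite o1 [ord0]o0; apply: etrans (block_mxEul _ _ _ _ _ _) _.
  by apply: etrans (block_mxEur _ _ _ _ _ _) _.
have f_row0 (B : kalg K) (x : U B) : row0_zero n.+1 m.+1 B (f1 B x).
  apply/row0_zero_tperm; split=> [|i]; rewrite /= mxE s0.
    rewrite [ord0]o0; apply: etrans (block_mxEul _ _ _ _ _ _) _.
    by apply: etrans (block_mxEul _ _ _ _ _ _) _; rewrite mxE.
  rewrite sK [ord0]o0; apply: etrans (block_mxEur _ _ _ _ _ _) _.
  apply: etrans (col_mxEu _ _ _ _) _.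
  by apply: etrans (row_mxEl _ _ _ _) _; rewrite mxE.
pose j : ktrans U (sym_row0 n.+1 m.+1) :=
  @sub_lift K (sym_functor K n.+2 k) _ (row0_zero n.+1 m.+1)
    (@row0_zero_stable n.+1 m.+1) f1 f_row0.
have i_row0 (B : kalg K) (A : sym_row0 n.+1 m.+2 B) : row0_zero n.+1 m.+1 B (sval A).
  by move=> l lm; apply: (svalP A); apply: leqW.
pose i : ktrans (sym_row0 n.+1 m.+2) (sym_row0 n.+1 m.+1) :=
  @sub_lift K (sym_functor K n.+2 k) _ (row0_zero n.+1 m.+1)
    (@row0_zero_stable n.+1 m.+1)
    (@sub_val K (sym_functor K n.+2 k) _ (@row0_zero_stable n.+1 m.+2)) i_row0.
pose t (B : kalg K) (A : sym_row0 n.+1 m.+1 B) : B :=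
  sval (sval A) ord0 (inord m.+1).
rewrite -!K0_classM.
apply: (K0_class_split (Z := sym_row0 n.+1 m.+2) (U := prod_variety V _)
  (t := t) (i := i) (j := j)).
- by move=> B C phi A; rewrite /t /= mxE.
- by apply: sub_lift_mono => B A A' /sval_inj.
- apply/sub_lift_mono/sub_lift_mono => B x y /(congr1 (mxsub s s)).
  rewrite !ssK; apply: (@schur_trans_mono K V 2 n k H H' R) => {B x y}.
  move=> B [[p dd] [w u]] [[p' dd'] [w' u']].
  move=> /(@eq_block_mx _ 1 1 1 1)[_ pp' _ /= dd_eq].
  move=> /(@eq_col_mx _ 1 1)[/eq_row_mx[_ /= ww'] /= uu'].
  rewrite /d /= in dd_eq; rewrite dd_eq ww' uu'.
  by congr (_, _, _); apply: Gm_val_mono.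
- move=> B A; rewrite sub_lift_image; split=> [[A2 A2A]|tA].
    by rewrite /t -A2A; apply: (svalP A2); rewrite inordK //; lia.
  have A2_row0 : row0_zero n.+1 m.+2 B (sval A).
    move=> l; rewrite ltnS leq_eqVlt => /orP[/eqP lm|]; last exact: (svalP A).
    by rewrite (_ : l = inord m.+1) // -lm inord_val.
  by exists (exist _ _ A2_row0).
- move=> B A; rewrite !sub_lift_image /t; split=> [[x <-]|[u Au]].
    rewrite /= mxE s0 sm schur01; exists (g' B x.1 0 0).
    by rewrite -mulmx11 gg' mxE.
  pose A0 : 'M_n.+2 := sval (sval A); pose A' : 'M_(2 + n) := mxsub s s A0.
  have [A'00 A'0] : A0 ord0 ord0 = 0 /\
      forall i : 'I_m, A0 ord0 (s (rshift 2 (lshift q i))) = 0.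
    exact/row0_zero_tperm/(svalP A).
  have rA' : sym_rank k A' by apply/(sym_rank_mxsub _ _ sK)/(svalP (sval A)).
  have [p pE] : kimage (Gm_val K) ((A' ord0 (inord 1))%:M : affine_space K 1 B).
    apply/Gm_val_image; exists u; rewrite !mxE eqxx mulr1n -Au s0.
    by congr (A0 _ _ * _); rewrite -sm sK.
  (* The data are read off the swapped matrix [A']; it remains to check that they reproduce its two
     upper blocks. *)
  pose v : V B := ((p, (A' (inord 1) (inord 1))%:M),
    (@rsubmx _ 1 m q (@usubmx _ 1 1 n (ursubmx A')), @dsubmx _ 1 1 n (ursubmx A'))).
  suff [x xA'] : kimage (schur_trans k H H' R) (A' : mx_functor K (2 + n) (2 + n) B).
    by exists x; rewrite /= [schur_mx _ _ _ _]xA' ssK.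
  apply: (@schur_trans_image K V 2 n k H H' R symH invH B A' v rA').
    have gE : g B v = (A' ord0 (inord 1))%:M by exact: pE.
    have symA' : A'^T = A' by case: rA'.
    pose L := @ulsubmx _ 2 n 2 n A'.
    have e1 : @ulsubmx _ 1 1 1 1 L = 0.
      by apply/mx11P; rewrite !mxE -!o0 s0.
    have e2 : @ursubmx _ 1 1 1 1 L = (A' ord0 (inord 1))%:M.
      by apply/mx11P; rewrite 4!mxE -o0 -o1 [RHS]mxE eqxx mulr1n.
    have e3 : @dlsubmx _ 1 1 1 1 L = (A' ord0 (inord 1))%:M.
      apply/mx11P; rewrite 4!mxE -o0 -o1 [RHS]mxE eqxx mulr1n.
      by rewrite -[in LHS]symA' mxE.
    have e4 : @drsubmx _ 1 1 1 1 L = (A' (inord 1) (inord 1))%:M.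
      by apply/mx11P; rewrite 4!mxE -o1 [RHS]mxE eqxx mulr1n.
    rewrite -/L -[L](@submxK _ 1 1 1 1) e1 e2 e3 e4.
    by rewrite /= gE.
  pose T := @ursubmx _ 2 n 2 n A'.
  (* These are the leading zeros of the first row, in the positions to which the swap moves them. *)
  have T0 : @lsubmx _ 1 m q (@usubmx _ 1 1 n T) = 0.
    apply/matrixP => a b; rewrite 4!mxE ord1 -o0 [RHS]mxE.
    by rewrite -[RHS](A'0 b) -[in RHS]s0 !mxE.
  rewrite -/T -[LHS](@vsubmxK _ 1 1 n) -[@usubmx _ 1 1 n T](@hsubmxK _ 1 m q) T0.
  by [].
Qed.

End Strata.

(** * Evaluation of integer polynomials in K_0 *)

Section Eval.
Context (K : fieldType) (x : K0 K).

Lemma K0_addr0 (y : K0 K) : K0_add y K0_zero = y.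
Proof. by rewrite K0_addC K0_add0. Qed.

Lemma K0_of_intS (z : int) :
  K0_of_int K (z + 1) = K0_add K0_one (K0_of_int K z).
Proof.
case: z => [p|[|p]]; first by rewrite -PoszD addn1.
  by rewrite /= K0_addr0 K0_addN.
have -> : Negz p.+1 + 1 = Negz p by lia.
have -> : K0_of_int K (Negz p.+1) =
    K0_opp (K0_add K0_one (iter p.+1 (K0_add K0_one) K0_zero)) by [].
by rewrite K0_oppD K0_addA K0_addN K0_add0.
Qed.

Lemma K0_of_intD (y z : int) :
  K0_of_int K (y + z) = K0_add (K0_of_int K y) (K0_of_int K z).
Proof.
elim: z => [|n IH|n IH]; first by rewrite addr0 K0_addr0.
  rewrite (_ : y + n.+1 = (y + n) + 1); last by lia.
  rewrite [in RHS](_ : Posz n.+1 = n%:Z + 1); last by lia.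
  by rewrite K0_of_intS IH K0_addA [K0_add K0_one _]K0_addC -K0_addA -K0_of_intS.
(* Adding one to both sides passes from [- n.+1] to [- n], where the induction hypothesis
   applies. *)
apply: (@K0_addI _ K0_one); rewrite -K0_of_intS.
rewrite (_ : y - n.+1%:Z + 1 = y - n%:Z); last by lia.
rewrite {}IH K0_addA [K0_add K0_one _]K0_addC -K0_addA -K0_of_intS.
by congr (K0_add _ (K0_of_int K _)); lia.
Qed.

Local Notation ev p := (K0_eval p x).

Lemma K0_eval0 : ev 0 = K0_zero.
Proof. by rewrite /K0_eval polyseq0. Qed.

Lemma K0_eval_MXaddC (p : {poly int}) (c : int) :
  ev (p * 'X + c%:P) = K0_add (K0_mul (ev p) x) (K0_of_int K c).
Proof.
rewrite -cons_poly_def /K0_eval polyseq_cons.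
(* For [p = 0] the coefficient list is that of the constant [c], empty if [c = 0], so one Horner
   step may be missing. *)
have [/nilP p0|//] := boolP (nilp p).
rewrite p0 /= K0_mul0 K0_add0 polyseqC.
by case: eqP => [->|_] //=; rewrite K0_mul0 K0_add0.
Qed.

Lemma K0_evalD (p q : {poly int}) : ev (p + q) = K0_add (ev p) (ev q).
Proof.
elim/poly_ind: p q => [|p c IH] q; first by rewrite add0r K0_eval0 K0_add0.
elim/poly_ind: q => [|q d _]; first by rewrite addr0 K0_eval0 K0_addr0.
rewrite addrACA -mulrDl -rmorphD !K0_eval_MXaddC IH K0_mulDl K0_of_intD.
exact: K0_addACA.
Qed.

Lemma K0_evalN (p : {poly int}) : ev (- p) = K0_opp (ev p).
Proof.
by apply: (@K0_addI _ (ev p)); rewrite -K0_evalD K0_addN subrr K0_eval0.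
Qed.

Lemma K0_evalMn (q : {poly int}) (n : nat) :
  ev (q *+ n) = K0_mul (K0_of_int K n) (ev q).
Proof.
elim: n => [|n IH]; first by rewrite mulr0n K0_eval0 K0_mul0.
by rewrite mulrS K0_evalD IH /= K0_mulDl K0_mul1.
Qed.

Lemma K0_evalMC (c : int) (q : {poly int}) :
  ev (c%:P * q) = K0_mul (K0_of_int K c) (ev q).
Proof.
case: c => n.
  by rewrite -[Posz n]natz rmorph_nat mulr_natl K0_evalMn natz.
rewrite NegzE -[Posz n.+1]natz rmorphN rmorph_nat mulNr mulr_natl K0_evalN.
by rewrite K0_evalMn natz -NegzE K0_mulNl.
Qed.

(** With additivity this makes evaluation a ring morphism, so the recurrence can be handled as an
    identity between polynomials. *)
Lemma K0_evalM (p q : {poly int}) : ev (p * q) = K0_mul (ev p) (ev q).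
Proof.
elim/poly_ind: p => [|p c IH]; first by rewrite mul0r K0_eval0 K0_mul0.
rewrite K0_eval_MXaddC mulrDl K0_evalD K0_evalMC mulrAC.
rewrite -[_ * 'X]addr0 -[0]/(0%:P) K0_eval_MXaddC IH K0_addr0.
by rewrite K0_mulDl -!K0_mulA [K0_mul (ev q) x]K0_mulC.
Qed.

Lemma K0_eval1 : ev 1 = K0_one.
Proof. by rewrite /K0_eval polyseq1 /= K0_mul0 K0_add0 K0_addr0. Qed.

Lemma K0_evalX : ev 'X = x.
Proof.
by rewrite -['X]mul1r -[1 * _]addr0 -[0]/(0%:P) K0_eval_MXaddC K0_eval1
  K0_mul1 K0_addr0.
Qed.

End Eval.

(** * The recurrence *)

Section Count.
Context (F : fieldType) (q : F).

(** Rounding down in [k %/ 2] covers both parities of the closed formula. The field is later the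
    fraction field of Z[X], with [q] the variable. *)
Definition sym_count_den (k : nat) : F :=
  \prod_(1 <= i < (k %/ 2).+1) (q ^+ (2 * i) / (q ^+ (2 * i) - 1)).
Definition sym_count_num (n k : nat) : F := \prod_(0 <= i < k) (q ^+ (n - i) - 1).
Definition sym_count (n k : nat) : F := sym_count_den k * sym_count_num n k.

Lemma sym_count_num_gt (n k : nat) : (n < k)%N -> sym_count_num n k = 0.
Proof.
(* The factor with [i = n] is [q ^+ 0 - 1 = 0]. *)
move=> nk; rewrite /sym_count_num (big_cat_nat (n := n)) //=; last exact: ltnW.
by rewrite [X in _ * X]big_ltn // subnn expr0 subrr mul0r mulr0.
Qed.

Lemma sym_count_gt (n k : nat) : (n < k)%N -> sym_count n k = 0.
Proof. by move=> nk; rewrite /sym_count sym_count_num_gt ?mulr0. Qed.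

Lemma sym_count_numSS (n k : nat) :
  sym_count_num n.+1 k.+1 = (q ^+ n.+1 - 1) * sym_count_num n k.
Proof. by rewrite /sym_count_num big_nat_recl. Qed.

Lemma sym_count_n0 (n : nat) : sym_count n 0 = 1.
Proof. by rewrite /sym_count /sym_count_den /sym_count_num !big_geq ?mulr1. Qed.

Lemma sym_count_n1 (n : nat) : sym_count n 1 = q ^+ n - 1.
Proof.
by rewrite /sym_count /sym_count_den /sym_count_num big_geq // big_nat1 mul1r subn0.
Qed.

Lemma sym_count_rec1 (n : nat) :
  sym_count n.+1 1 = (q - 1) * q ^+ n * sym_count n 0 + sym_count n 1.
Proof. rewrite !sym_count_n1 sym_count_n0 exprS; ring. Qed.

Hypothesis q_nunity : forall m, (0 < m)%N -> q ^+ m != 1.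

(** All terms share the factors [sym_count_den k] and [sym_count_num] at a common index. What is
    left is a rational identity in [q] and two of its powers, whose shape depends on the parity of
    [k]. *)
Lemma sym_count_rec2 (n k : nat) :
  sym_count n.+1 k.+2 =
  (q - 1) * q ^+ n * sym_count n k.+1 +
  (sym_count n k.+2 + (q ^+ n - 1) * q ^+ n * sym_count n.-1 k).
Proof.
(* For [n = 0] the coefficient [q ^+ 0 - 1] removes the term with the truncated [n.-1]. *)
case: n => [|n].
  by rewrite !(sym_count_gt (k := k.+2)) // (sym_count_gt (k := k.+1)) // expr0; ring.
rewrite /= /sym_count !sym_count_numSS.
have -> : sym_count_num n k.+1 = sym_count_num n k * (q ^+ (n - k) - 1).
  by rewrite /sym_count_num big_nat_recr.
have [nk|kn] := ltnP n k; first by rewrite sym_count_num_gt //; ring.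
have -> : sym_count_den k.+2 = sym_count_den k *
    (q ^+ (2 * (k %/ 2).+1) / (q ^+ (2 * (k %/ 2).+1) - 1)).
  rewrite /sym_count_den (_ : k.+2 %/ 2 = (k %/ 2).+1)%N; last by lia.
  by rewrite big_nat_recr.
have den0 : q ^+ (2 * (k %/ 2).+1) - 1 != 0 by rewrite subr_eq0 q_nunity.
have den1 : sym_count_den k.+1 = if odd k then sym_count_den k *
    (q ^+ (2 * (k %/ 2).+1) / (q ^+ (2 * (k %/ 2).+1) - 1)) else sym_count_den k.
  case: ifP => ok; rewrite /sym_count_den.
    have -> : (k.+1 %/ 2 = (k %/ 2).+1)%N by lia.
    by rewrite big_nat_recr.
  by have -> : (k.+1 %/ 2 = k %/ 2)%N by lia.
have qn : q ^+ n = q ^+ (n - k) * q ^+ k by rewrite -exprD subnK.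
(* The new denominator has exponent [k.+1] for odd [k] and [k.+2] for even [k]; only for odd [k]
   does it also occur in [sym_count_den k.+1]. *)
rewrite {}den1; case: ifP den0 => ok.
  rewrite (_ : (2 * _ = k.+1)%N); last by lia.
  rewrite !exprS {}qn => den0; field.
  by [].
rewrite (_ : (2 * _ = k.+2)%N); last by lia.
rewrite !exprS {}qn => den0; field.
by [].
Qed.

End Count.

(** * The recurrence in K_0 and its solution *)

Section Recurrence.
Context (K : fieldType).
Local Notation ev p := (K0_eval p (K0_lefschetz K)).
Local Notation S n k := (K0_class (sym_variety K n k)).

Lemma K0_class_affine (n : nat) : K0_class (affine_space K n) = ev 'X^n.
Proof.
elim: n => [|n IH]; first by rewrite expr0 K0_eval1 K0_class_affine0.
by rewrite K0_class_affineS IH exprS K0_evalM K0_evalX.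
Qed.

Lemma K0_class_Gm_eval : K0_class (Gm K) = ev ('X - 1).
Proof.
apply: (@K0_addI _ K0_one); rewrite -K0_class_Gm -(K0_eval1 (K0_lefschetz K)) -K0_evalD.
by rewrite addrC subrK K0_evalX.
Qed.

(** The strata for the remaining pivot columns contribute [(L - 1) L^j L^(m+q+1) P2] for [j] from 0
    to [q], a geometric sum. The induction moves one unit from [q] to [m], keeping [m + q] fixed. *)
Lemma K0_class_sym_row0 (k : int) (m q : nat) (P0 P2 : {poly int}) :
  S (m + q).+1 k = ev P0 -> S (m + q) (k - 2) = ev P2 ->
  K0_class (sym_row0 K k (m + q).+1 m.+1) =
  ev (P0 + ('X^(q.+1) - 1) * 'X^((m + q).+1) * P2).
Proof.
elim: q m => [|q IH] m S0 S2; rewrite K0_class_sym_pivot2 S2.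
  rewrite !K0_class_affine K0_class_Gm_eval -!K0_evalM.
  rewrite [in sym_row0 _ _ _ _]addn0 K0_class_sym_row0_all.
  move: S0; rewrite addn0 => ->; rewrite -K0_evalD; congr K0_eval.
  rewrite !exprS expr0; ring.
rewrite addnS -addSn in S0 S2 *; rewrite (IH m.+1 S0 S2).
rewrite !K0_class_affine K0_class_Gm_eval -!K0_evalM -K0_evalD.
congr K0_eval; rewrite !exprS; ring.
Qed.

Lemma K0_class_sym_rec (k : int) (n : nat) (P0 P1 P2 : {poly int}) :
  S n k = ev P0 -> S n (k - 1) = ev P1 -> S n.-1 (k - 2) = ev P2 ->
  S n.+1 k = ev (('X - 1) * 'X^n * P1 + (P0 + ('X^n - 1) * 'X^n * P2)).
Proof.
move=> S0 S1 S2; rewrite K0_class_sym_pivot1 S1 K0_class_Gm_eval K0_class_affine.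
have -> : K0_class (sym_row0 K k n 1) = ev (P0 + ('X^n - 1) * 'X^n * P2).
  (* For [n = 0] the first row is the corner entry alone, and the factor ['X^0 - 1] cancels the last
     term. *)
  case: n S0 S2 {S1} => [|n] S0 S2.
    by rewrite K0_class_sym_row0_all S0 expr0 subrr !mul0r addr0.
  by rewrite (@K0_class_sym_row0 k 0 n P0 P2).
by rewrite K0_addC -!K0_evalM -K0_evalD.
Qed.

Lemma K0_class_sym_empty (n : nat) (k : int) :
  n%:Z < k \/ k < 0 -> S n k = K0_zero.
Proof.
move=> nk; apply: K0_class_empty => B [A rA].
by case: nk => ?; [apply: sym_rank_gt rA|apply: sym_rank_lt0 rA].
Qed.

Lemma K0_class_sym00 : S 0 0 = K0_one.
Proof.
have nat0 (B C : kalg K) (phi : khom B C) (x : sym_variety K 0 0 B) :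
  tt = fmap (point_variety K) phi tt by [].
pose f := @KTrans K (sym_variety K 0 0) (point_variety K) (fun B _ => tt) nat0.
apply: (K0_class_bij (f := f)) => [B x y _|B []].
  by apply/sval_inj/matrixP => -[].
by exists (exist _ 0 (sym_rank_dim0 0)).
Qed.

Local Notation q := (tofrac ('X : {poly int})).

(** ['X^m - 1] is monic, hence nonzero, and stays so in the fraction field. *)
Lemma tofracX_nunity (m : nat) : (0 < m)%N -> q ^+ m != 1.
Proof.
move=> m0; rewrite -subr_eq0 -rmorphXn -(rmorph1 (@tofrac {poly int})) -rmorphB.
by rewrite tofrac_eq0 monic_neq0 // monicXnsubC.
Qed.

(** The recurrence itself produces [P] with integer coefficients; its image in the fraction field
    obeys the recurrence of the closed formula. Division thus takes place only in the fraction
    field, never in K_0. *)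
Lemma K0_class_sym (n k : nat) :
  exists2 P : {poly int}, tofrac P = sym_count q n k & S n k = ev P.
Proof.
(* The recurrence reaches back two sizes, so the induction carries both [n] and [n.-1]. *)
suff [] : (forall k : nat, exists2 P : {poly int},
    tofrac P = sym_count q n k & S n k = ev P) /\
  (forall k : nat, exists2 P : {poly int},
    tofrac P = sym_count q n.-1 k & S n.-1 k = ev P) by [].
elim: n => [|n [IH IH']].
  suff base j : exists2 P : {poly int}, tofrac P = sym_count q 0 j & S 0 j = ev P.
    by [].
  case: j => [|j].
    by exists 1; rewrite ?sym_count_n0 ?rmorph1 // K0_eval1 K0_class_sym00.
  exists 0; first by rewrite sym_count_gt // rmorph0.
  by rewrite K0_eval0 K0_class_sym_empty //; left.
split=> //= j; have [P0 P0E S0] := IH j.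
have neg n' (z : int) : z < 0 -> S n' z = ev 0.
  by move=> z0; rewrite K0_eval0 K0_class_sym_empty //; right.
(* For ranks 0 and 1 some of the ranks [k - 1] and [k - 2] are negative; those varieties are empty
   and enter with the polynomial 0. *)
case: j P0E S0 => [|[|j]] P0E S0.
- exists P0; first by rewrite P0E !sym_count_n0.
  rewrite (K0_class_sym_rec S0 (neg _ _ _) (neg _ _ _)) //.
  by rewrite !mulr0 add0r addr0.
- have [P1 P1E S1] := IH 0%N.
  rewrite (_ : Posz 0 = 1%:Z - 1) // in S1.
  have S2 : S n.-1 (1%:Z - 2) = ev 0 by apply: neg.
  eexists; last exact: (K0_class_sym_rec S0 S1 S2).
  rewrite sym_count_rec1 -P0E -P1E mulr0 addr0.
  by rewrite rmorphD !rmorphM rmorphB rmorphXn rmorph1.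
have [P1 P1E S1] := IH j.+1; have [P2 P2E S2] := IH' j.
rewrite (_ : Posz j.+1 = j.+2%:Z - 1) in S1; last by lia.
rewrite (_ : Posz j = j.+2%:Z - 2) in S2; last by lia.
eexists; last exact: (K0_class_sym_rec S0 S1 S2).
rewrite (sym_count_rec2 tofracX_nunity) -P0E -P1E -P2E.
by rewrite !(rmorphD, rmorphM, rmorphN, rmorphXn, rmorph1).
Qed.

End Recurrence.

Theorem theorem1p2 (K : fieldType) (charK : 2%N \notin [pchar K]) (n : nat) :
  [/\ forall k : int, n%:Z < k \/ k < 0 ->
        K0_class (sym_variety K n k) = K0_zero,
      K0_class (sym_variety K n 0) = K0_one
    & forall k : nat, (0 < k <= n)%N ->
        exists2 P : {poly int},
          (* P is the quotient, computed in the field of fractions of Z[X] *)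
          tofrac P =
            if odd k then
              (\prod_(1 <= i < ((k - 1) %/ 2).+1)
                 (tofrac 'X^(2 * i) / tofrac ('X^(2 * i) - 1))) *
              (\prod_(0 <= i < k) tofrac ('X^(n - i) - 1))
            else
              (\prod_(1 <= i < (k %/ 2).+1)
                 (tofrac 'X^(2 * i) / tofrac ('X^(2 * i) - 1))) *
              (\prod_(0 <= i < k) tofrac ('X^(n - i) - 1))
        & K0_class (sym_variety K n k%:Z) = K0_eval P (K0_lefschetz K) ].
Proof.
split=> [k||k _].
- exact: K0_class_sym_empty.
- have [P + ->] := K0_class_sym K n 0.
  (* The embedding into the fraction field is injective, so [P] is [1]. *)
  rewrite sym_count_n0 -tofrac1 => /eqP; rewrite tofrac_eq => /eqP ->.
  exact: K0_eval1.
have [P PE SP] := K0_class_sym K n k; exists P => //; rewrite {}PE.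
have XnE m : tofrac ('X^m : {poly int}) = tofrac 'X ^+ m by rewrite rmorphXn.
have Xn1E m : tofrac ('X^m - 1 : {poly int}) = tofrac 'X ^+ m - 1.
  by rewrite rmorphB rmorphXn rmorph1.
have numE : \prod_(0 <= i < k) tofrac ('X^(n - i) - 1 : {poly int}) =
    sym_count_num (tofrac 'X) n k.
  by apply: eq_bigr => i _; rewrite Xn1E.
have denE m : \prod_(1 <= i < m)
      (tofrac ('X^(2 * i) : {poly int}) / tofrac ('X^(2 * i) - 1)) =
    \prod_(1 <= i < m) (tofrac 'X ^+ (2 * i) / (tofrac 'X ^+ (2 * i) - 1)).
  by apply: eq_bigr => i _; rewrite XnE Xn1E.
rewrite numE !denE -/(sym_count_den _ k); case: ifP => // ok.
(* For odd [k], halving [k - 1] and halving [k] rounded down agree. *)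
by have -> : ((k - 1) %/ 2 = k %/ 2)%N by lia.
Qed.
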